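(* Let $X$ be a L\'evy process with L\'evy measure $\nu$ such that $\nu[x,\infty)$ is regularly varying at infinity with index $-\alpha$ and $\nu(-\infty,-x]$ is regularly varying at infinity with index $-\beta$, where $\alpha,\beta>1$, and let $\bar X_n$ be the centered and scaled process defined in the context. Define, for $\xi\in\mathbb D$, $$I(\xi)=\begin{cases}(\alpha-1)\mathcal D_+(\xi)+(\beta-1)\mathcal D_-(\xi),&\text{if }\xi\text{ is a step function and }\xi(0)=0;\\ \infty,&\text{otherwise.}\end{cases}$$ Then $\bar X_n$ does not satisfy a full (strong) large deviation principle with speed $\log n$ and rate function $I$: the upper bound $$\limsup_{n\to\infty}\frac{\log\mathbf P(\bar X_n\in F)}{\log n}\le-\inf_{\xi\in F}I(\xi)$$ does not hold for all closed sets $F\subseteq\mathbb D$.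
   Context: Process: $X$ has It\^o representation $X(s)=sa+B(s)+\int_{|x|\le1}x[N([0,s]\times dx)-s\nu(dx)]+\int_{|x|>1}xN([0,s]\times dx)$, with $a$ a drift parameter, $B$ a Brownian motion, and $N$ a Poisson random measure with mean measure Lebesgue $\times\,\nu$. Set $\bar X_n(s)=\frac1nX(ns)-sa-s\int_{|x|>1}x\,\nu(dx)$, $s\in[0,1]$. $\mathbb D=\mathbb D([0,1],\mathbb R)$ is the space of real-valued right-continuous functions with left limits on $[0,1]$ with the Skorokhod $J_1$ topology, given by the metric $d(x,y)=\inf_{\lambda\in\Lambda}\|\lambda-e\|\vee\|x\circ\lambda-y\|$ ($\Lambda$: non-decreasing homeomorphisms of $[0,1]$ onto itself, $e$ the identity, $\|\cdot\|$ supremum norm). $\mathcal D_+(\xi)$ and $\mathcal D_-(\xi)$ denote the numbers of upward and downward jumps of $\xi$. The infimum over the empty set is $\infty$, and $\log0=-\infty$. *)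

(* Defs.v *)
From HB Require Import structures.
From mathcomp Require Import all_boot all_order all_algebra.
From mathcomp Require Import all_classical all_reals all_analysis.
From mathcomp Require Import measurable_realfun.

Set Implicit Arguments.
Unset Strict Implicit.
Unset Printing Implicit Defensive.
Import Order.TTheory GRing.Theory Num.Theory.
Import numFieldNormedType.Exports.

Local Open Scope classical_set_scope.
Local Open Scope ring_scope.

(* At an endpoint of J lying in J the filter within J t^'+ (or t^'-) is
   improper, so the corresponding one-sided condition is vacuous there. *)
Definition cadlag_on (R : realType) (J : set R) (f : R -> R) :=
  forall t, J t ->
    f s @[s --> within J t^'+] --> f t /\
    exists l : R, f s @[s --> within J t^'-] --> l.

Record cadlag_path (R : realType) := CadlagPath {
  cadlag_path_fun :> R -> R;
  cadlag_pathP : cadlag_on `[0, +oo[ cadlag_path_fun }.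

(* The space D([0,1], R). Paths are extended by 0 outside [0,1], so that two
   elements are equal exactly when they agree on [0,1]. *)
Record skorokhod (R : realType) := Skorokhod {
  skorokhod_fun :> R -> R;
  skorokhod_cadlag : cadlag_on `[0, 1] skorokhod_fun;
  skorokhod_out : forall t, ~ `[0, 1]%classic t -> skorokhod_fun t = 0 }.

Section J1_topology.
Context {R : realType}.
Implicit Types (x y z : skorokhod R) (l m : R -> R).

Definition homeomorphisms01 l m :=
  [/\ {homo l : s / `[0, 1]%classic s}, {homo m : s / `[0, 1]%classic s},
      forall s, `[0, 1]%classic s -> m (l s) = s /\ l (m s) = s,
      {within `[0, 1], continuous l} & {within `[0, 1], continuous m}].

Definition time_changes : set (R -> R) :=
  [set l | (forall s t, 0 <= s -> s <= t -> t <= 1 -> l s <= l t) /\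
           exists m, homeomorphisms01 l m].

Definition supnorm (f : R -> R) : \bar R :=
  ereal_sup [set `|f s|%:E | s in `[0, 1]].

Definition J1_dist x y : \bar R :=
  ereal_inf [set maxe (supnorm (fun s => l s - s))
                      (supnorm (fun s => x (l s) - y s)) | l in time_changes].

Definition J1_ball x (e : R) : set (skorokhod R) :=
  [set y | (J1_dist x y < e%:E)%E].

Lemma supnorm_le (f : R -> R) (e : R) :
  (supnorm f <= e%:E)%E <-> forall s, `[0, 1]%classic s -> `|f s| <= e.
Proof.
split=> [fe s s01|fe].
  by rewrite -lee_fin (le_trans _ fe)//; apply: ereal_sup_ubound; exists s.
by apply: ge_ereal_sup => _ [s s01 <-]; rewrite lee_fin fe.
Qed.

Lemma J1_ballP x y (e : R) : J1_ball x e y <->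
  exists e', [/\ e' < e & exists2 l, time_changes l & forall s, `[0, 1]%classic s ->
     `|l s - s| <= e' /\ `|x (l s) - y s| <= e'].
Proof.
split=> [/ereal_inf_lt[_ [l Ll <-]] le|[e' [e'e [l Ll le]]]].
  set M := maxe _ _ in le.
  have M0 : (0 <= M)%E.
    rewrite le_max; apply/orP; left; apply: (@le_trans _ _ `|l 0 - 0|%:E).
      by rewrite lee_fin.
    by apply: ereal_sup_ubound; exists 0 => //=; rewrite in_itv /= lexx ler01.
  have Mfin : M \is a fin_num by rewrite ge0_fin_numE// (lt_trans le)// ltry.
  exists (fine M); split; first by rewrite -lte_fin fineK.
  exists l => // s s01; split.
    by move: s s01; apply/supnorm_le; rewrite fineK// le_max lexx.
  by move: s s01; apply/supnorm_le; rewrite fineK// le_max lexx orbT.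
apply: (@le_lt_trans _ _ e'%:E); last by rewrite lte_fin.
apply: (@le_trans _ _ (maxe (supnorm (fun s => l s - s))
   (supnorm (fun s => x (l s) - y s)))).
  by apply: ereal_inf_lbound; exists l.
by rewrite ge_max; apply/andP; split; apply/supnorm_le => s /le[].
Qed.

Lemma time_changes_id : time_changes id.
Proof.
by split=> //; exists id; split => //; apply: continuous_subspaceT => ?; exact: cvg_id.
Qed.

Lemma time_changes_inv l : time_changes l ->
  exists2 m, time_changes m & homeomorphisms01 l m.
Proof.
move=> [lnd [m lm]]; exists m => //; have [ll mm K cl cm] := lm; split; last first.
  by exists l; split=> // s s01; have [] := K s s01; split.
move=> s t s0 st t1; rewrite leNgt; apply/negP => mts.
have s01 : `[0, 1]%classic s by rewrite /= in_itv /= s0 (le_trans st).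
have t01 : `[0, 1]%classic t by rewrite /= in_itv /= t1 (le_trans s0).
have := mm _ s01; have := mm _ t01.
rewrite /= !in_itv /= => /andP[a b] /andP[c e].
have := lnd _ _ a (ltW mts) e; rewrite (K s s01).2 (K t t01).2 => ts.
have E : s = t by apply/eqP; rewrite eq_le st ts.
by rewrite E ltxx in mts.
Qed.

Lemma within01_comp l m : {homo l : s / `[0, 1]%classic s} ->
  {within `[0, 1], continuous l} -> {within `[0, 1], continuous m} ->
  {within `[0, 1], continuous (m \o l)}.
Proof.
move=> ll /subspace_continuousP cl /subspace_continuousP cm.
apply/subspace_continuousP => t t01; apply: cvg_comp (cm _ (ll _ t01)).
move=> U; rewrite {1}/within /= => /(cl _ t01).
rewrite /within /= !nbhs_simpl /= => H.
by near=> s => s01; have := near H s => /(_ _ s01 (ll _ s01)); apply.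
Unshelve. all: by end_near. Qed.

Lemma time_changes_comp l m :
  time_changes l -> time_changes m -> time_changes (m \o l).
Proof.
move=> [lnd [l' [ll ll' Kl cl cl']]] [mnd [m' [mm mm' Km cm cm']]]; split.
  move=> s t s0 st t1 /=.
  have s01 : `[0, 1]%classic s by rewrite /= in_itv /= s0 (le_trans st).
  have t01 : `[0, 1]%classic t by rewrite /= in_itv /= t1 (le_trans s0).
  have := ll _ s01; have := ll _ t01.
  rewrite /= !in_itv /= => /andP[a b] /andP[c e].
  by apply: mnd => //; exact: lnd.
exists (l' \o m'); split; [| | |exact: within01_comp|exact: within01_comp].
- by move=> s /ll /mm.
- by move=> s /mm' /ll'.
- move=> s s01 /=; split.
    by rewrite (Km _ (ll _ s01)).1 (Kl _ s01).1.
  by rewrite (Kl _ (mm' _ s01)).2 (Km _ s01).2.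
Qed.

Let J1_ball_center x (e : R) : 0 < e -> J1_ball x e x.
Proof.
move=> e0; apply/J1_ballP; exists 0; split=> //; exists id => [|s _].
  exact: time_changes_id.
by rewrite !subrr normr0.
Qed.

Let J1_ball_sym x y (e : R) : J1_ball x e y -> J1_ball y e x.
Proof.
move=> /J1_ballP[e' [e'e [l /time_changes_inv[m mT [ll mm K _ _]] le]]].
apply/J1_ballP; exists e'; split=> //; exists m => // s s01.
have [] := le _ (mm _ s01); rewrite (K s s01).2 => h1 h2.
by split; rewrite distrC.
Qed.

Let J1_ball_triangle x y z (e1 e2 : R) :
  J1_ball x e1 y -> J1_ball y e2 z -> J1_ball x (e1 + e2) z.
Proof.
move=> /J1_ballP[e1' [h1 [l lT le1]]] /J1_ballP[e2' [h2 [m mT le2]]].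
apply/J1_ballP; exists (e1' + e2'); split; first exact: ltrD.
exists (l \o m) => [|s s01]; first exact: time_changes_comp.
have [_ [? [mm _ _ _ _]]] := mT.
have [a b] := le1 _ (mm _ s01); have [c e] := le2 _ s01; split => /=.
  rewrite -(subrKA (m s)) (le_trans (ler_normD _ _))//; exact: lerD.
rewrite -(subrKA (y (m s))) (le_trans (ler_normD _ _))//; exact: lerD.
Qed.

Let J1_ent : set_system (skorokhod R * skorokhod R) := entourage_ J1_ball.

HB.instance Definition _ := gen_eqMixin (skorokhod R).
HB.instance Definition _ := gen_choiceMixin (skorokhod R).
HB.instance Definition _ := hasNbhs.Build (skorokhod R) (nbhs_ J1_ent).
HB.instance Definition _ := @Nbhs_isPseudoMetric.Build R (skorokhod R)
  J1_ent erefl J1_ball J1_ball_center J1_ball_sym J1_ball_triangle erefl.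

End J1_topology.

Section rate_function.
Context {R : realType}.
Implicit Type xi : skorokhod R.

Definition left_limit (f : R -> R) (t : R) : R := lim (f s @[s --> t^'-]).

Definition upward_jumps xi : \bar R :=
  counting [set t : R | 0 < t <= 1 /\ left_limit xi t < xi t].

Definition downward_jumps xi : \bar R :=
  counting [set t : R | 0 < t <= 1 /\ xi t < left_limit xi t].

Definition step_function xi := exists (k : nat) (t : nat -> R),
  [/\ t 0%N = 0, t k = 1 & forall i, (i < k)%N -> t i < t i.+1 /\
     forall s, t i <= s < t i.+1 -> xi s = xi (t i)].

Definition rate_I (alpha beta : R) xi : \bar R :=
  if `[< step_function xi /\ xi 0 = 0 >] then
    ((alpha - 1)%:E * upward_jumps xi + (beta - 1)%:E * downward_jumps xi)%E
  else +oo%E.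

End rate_function.

Section large_deviations.
Context {R : realType} {d} {T : measurableType d} (P : probability T R).
Context {S : topologicalType} (Y : nat -> T -> S).
Local Open Scope ereal_scope.

Definition ldp_upper_bound (speed : nat -> R) (I : S -> \bar R) :=
  forall F : set S, closed F ->
    limn_esup (fun n => lne (P (Y n @^-1` F)) * ((speed n)^-1)%:E)
      <= - ereal_inf [set I xi | xi in F].

Definition ldp_lower_bound (speed : nat -> R) (I : S -> \bar R) :=
  forall G : set S, open G ->
    - ereal_inf [set I xi | xi in G]
      <= limn_einf (fun n => lne (P (Y n @^-1` G)) * ((speed n)^-1)%:E).

Definition full_ldp (speed : nat -> R) (I : S -> \bar R) :=
  ldp_upper_bound speed I /\ ldp_lower_bound speed I.

End large_deviations.

Section independence.
Context {R : realType} {d} {T : measurableType d} (P : probability T R).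

Definition mutually_independent {d'} {E : measurableType d'} (k : nat)
    (Y : 'I_k -> T -> E) :=
  forall C : 'I_k -> set E, (forall i, measurable (C i)) ->
    P (\bigcap_(i in [set: 'I_k]) (Y i @^-1` C i)) =
    (\prod_(i < k) P (Y i @^-1` C i))%E.

Definition sigma_generated {d'} {E : measurableType d'} {J : Type}
    (D : set J) (Y : J -> T -> E) : set (set T) :=
  <<s [set A | exists2 j, D j & exists2 C, measurable C & A = Y j @^-1` C] >>.

Definition independent_sigma (G H : set (set T)) :=
  forall A B, G A -> H B -> P (A `&` B) = (P A * P B)%E.

End independence.

Section levy_processes.
Context {R : realType} {d} {T : measurableType d} (P : probability T R).

Definition independent_increments (Y : T -> R -> R) :=
  forall (k : nat) (t : nat -> R), 0 <= t 0%N -> (forall i, t i <= t i.+1) ->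
    mutually_independent P (fun (i : 'I_k) w => Y w (t i.+1) - Y w (t i)).

Definition levy_process (X : T -> R -> R) :=
  [/\ forall t, 0 <= t -> measurable_fun setT (X ^~ t),
      {ae P, forall w, X w 0 = 0},
      independent_increments X,
      (forall s t (A : set R), 0 <= s <= t -> measurable A ->
        P [set w | A (X w t - X w s)] = P [set w | A (X w (t - s))]) &
      forall w, cadlag_on `[0, +oo[ (X w)].

(* normal_prob with zero standard deviation is not the Dirac mass at 0. *)
Definition centered_gaussian (s : R) (A : set R) : \bar R :=
  if s == 0 then \d_(0 : R) A else normal_prob 0 s A.

(* Brownian motion with variance sigma^2 per unit of time; sigma = 0, the
   absence of a Gaussian component, is allowed. *)
Definition brownian_motion (sigma : R) (B : T -> R -> R) :=
  [/\ forall t, 0 <= t -> measurable_fun setT (B ^~ t),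
      {ae P, forall w, B w 0 = 0},
      independent_increments B,
      (forall s t (A : set R), 0 <= s <= t -> measurable A ->
        P [set w | A (B w t - B w s)] =
        centered_gaussian (sigma * Num.sqrt (t - s)) A) &
      {ae P, forall w, {within `[0, +oo[, continuous (B w)}}].

Definition poisson_random_measure {d'} {E : measurableType d'}
    (mu : set E -> \bar R) (N : T -> {measure set E -> \bar R}) :=
  [/\ forall w A, measurable A ->
        N w A = +oo%E \/ exists k : nat, N w A = k%:R%:E,
      forall A, measurable A -> measurable_fun setT (N ^~ A),
      (forall A (k : nat), measurable A -> (mu A < +oo)%E ->
        P [set w | N w A = k%:R%:E] =
        (expR (- fine (mu A)) * fine (mu A) ^+ k / k`!%:R)%:E),
      forall A, measurable A -> mu A = +oo%E -> P [set w | N w A = +oo%E] = 1%E &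
      forall (k : nat) (A : 'I_k -> set E), (forall i, measurable (A i)) ->
        trivIset setT A -> mutually_independent P (fun i w => N w (A i))].

Definition levy_measure (nu : {measure set R -> \bar R}) :=
  nu [set 0] = 0%E /\ (\int[nu]_x (Num.min 1 (x ^+ 2))%:E < +oo)%E.

(* nu is sigma-finite as soon as levy_measure nu holds, so that \x is the
   usual product of the Lebesgue measure (restricted to [0,oo[) and nu. *)
Definition jump_intensity (nu : {measure set R -> \bar R}) (A : set (R * R)) :
    \bar R :=
  (lebesgue_measure \x nu)%E (A `&` (`[0, +oo[ `*` setT)).

Definition compensated_jumps (nu : {measure set R -> \bar R})
    (M : {measure set (R * R) -> \bar R}) (h s : R) : R :=
  \int[M]_(z in `[0, s] `*` [set x | h < `|x| <= 1]) z.2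
    - s * \int[nu]_(x in [set x | h < `|x| <= 1]) x.

(* The compensated integral over |x| <= 1 is the almost sure limit, locally
   uniform in time, of the integrals over h < |x| <= 1 as h decreases to 0. *)
Definition ito_representation (X : T -> R -> R) (a sigma : R)
    (B : T -> R -> R) (N : T -> {measure set (R * R) -> \bar R})
    (nu : {measure set R -> \bar R}) :=
  [/\ brownian_motion sigma B,
      poisson_random_measure (jump_intensity nu) N,
      independent_sigma P
        (sigma_generated [set t | 0 <= t] (fun t w => B w t))
        (sigma_generated measurable (fun A w => N w A)) &
      exists2 J : T -> R -> R,
        {ae P, forall w, forall t, 0 <= t ->
          {uniform `[0, t], compensated_jumps nu (N w) h @[h --> 0^'+] --> J w}} &
        {ae P, forall w, forall s, 0 <= s ->
          X w s = s * a + B w s + J w s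
            + \int[N w]_(z in `[0, s] `*` [set x | 1 < `|x|]) z.2}].

End levy_processes.

Definition regularly_varying (R : realType) (f : R -> R) (rho : R) :=
  exists x0 : R, [/\ measurable_fun `[x0, +oo[ f,
    forall x, x0 <= x -> 0 < f x &
    forall t, 0 < t -> f (t * x) / f x @[x --> +oo] --> t `^ rho].

Section scaled_process.
Context {R : realType}.

Definition scaled_path_fun (n : nat) (c : R) (x : cadlag_path R) : R -> R :=
  fun s => if s \in `[0, 1] then x (n%:R * s) / n%:R - s * c else 0.

Let scaled_path_cvg n c (x : cadlag_path R) (t l : R) (F : set_system R) :
    Filter F -> F `[0, 1]%classic -> F --> t ->
    x (n%:R * s) @[s --> F] --> l ->
  scaled_path_fun n c x s @[s --> F] --> l / n%:R - t * c.
Proof.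
move=> FF F01 Ft Fl.
apply: (@cvg_trans _ ((x (n%:R * s) / n%:R - s * c) @[s --> F])).
  apply: near_eq_cvg; near=> s; rewrite /scaled_path_fun ifT//.
  by near: s; exact: F01.
by apply: cvgB; apply: cvgMl.
Unshelve. all: by end_near. Qed.

Let scale_time (n : nat) (t : R) : n%:R * s @[s --> t] --> n%:R * t.
Proof. by apply: cvgMr; exact: cvg_id. Qed.

Lemma scaled_path_cadlag n c x : cadlag_on `[0, 1] (scaled_path_fun n c x).
Proof.
move=> t t01.
have t0 : 0 <= t by move: t01; rewrite /= in_itv /= => /andP[].
have nt0 : `[0, +oo[%classic (n%:R * t) by rewrite /= in_itv /= andbT mulr_ge0.
have nJ (s : R) : `[0, 1]%classic s -> `[0, +oo[%classic (n%:R * s).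
  by rewrite /= !in_itv /= andbT => /andP[s0 _]; rewrite mulr_ge0.
have [xr [l xl]] := cadlag_pathP x nt0.
have FJ (F : set_system R) : Filter F -> within `[0, 1] F `[0, 1]%classic.
  by move=> FF; rewrite /within /=; apply: filterE.
have Fr : within `[0, 1] t^'+ --> t.
  move=> U /= tU; rewrite nbhs_simpl /within /=.
  by apply: filterS tU.
have Fl : within `[0, 1] t^'- --> t.
  move=> U /= tU; rewrite nbhs_simpl /within /=.
  by apply: filterS tU.
case: n nt0 nJ xr xl => [|n] nt0 nJ xr xl.
  have x0 (F : set_system R) : Filter F ->
      x (0%:R * s) @[s --> F] --> x (0%:R * t).
    move=> FF; under eq_fun do rewrite mul0r; rewrite mul0r; exact: cvg_cst.
  split; last exists (x (0%:R * t) / 0%:R - t * c).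
    rewrite {2}/scaled_path_fun ifT//.
    by apply: scaled_path_cvg; [exact: FJ|exact: Fr|exact: x0].
  by apply: scaled_path_cvg; [exact: FJ|exact: Fl|exact: x0].
have n0 : 0 < n.+1%:R :> R by rewrite ltr0n.
split; last exists (l / n.+1%:R - t * c).
  rewrite {2}/scaled_path_fun ifT//; apply: scaled_path_cvg => //; first exact: FJ.
  apply: cvg_comp xr => U /(@scale_time n.+1 t) H.
  rewrite nbhs_simpl /fmap /within /=.
  rewrite /at_right /within /=; rewrite nbhs_simpl /fmap /= in H.
  apply: filterS H => s /= H ts s01.
  by apply: H; [rewrite ltr_pM2l|exact: nJ].
apply: scaled_path_cvg => //; first exact: FJ.
apply: cvg_comp xl => U /(@scale_time n.+1 t) H.
rewrite nbhs_simpl /fmap /within /=.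
rewrite /at_left /within /=; rewrite nbhs_simpl /fmap /= in H.
apply: filterS H => s /= H ts s01.
by apply: H; [rewrite ltr_pM2l|exact: nJ].
Unshelve. all: by end_near. Qed.

Lemma scaled_path_out n c x t : ~ `[0, 1]%classic t -> scaled_path_fun n c x t = 0.
Proof. by rewrite /scaled_path_fun /=; case: ifP. Qed.

Definition scaled_path n c x : skorokhod R :=
  Skorokhod (@scaled_path_cadlag n c x) (@scaled_path_out n c x).

(* The events {w | scaled_process X a nu n w \in F}, F closed, are measurable
   for a Levy process X: the J1-Borel sigma-algebra is the one generated by the
   evaluations. At n = 0 the path is junk, which limits ignore. *)
Definition scaled_process {T : Type} (X : T -> cadlag_path R) (a : R)
    (nu : {measure set R -> \bar R}) (n : nat) (w : T) : skorokhod R :=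
  scaled_path n (a + \int[nu]_(x in [set x | 1 < `|x|]) x) (X w).

End scaled_process.

(* Main.v *)
Require Import Defs.
From HB Require Import structures.
From mathcomp Require Import all_boot all_order all_algebra.
From mathcomp Require Import all_classical all_reals all_analysis.
From mathcomp Require Import measurable_realfun ring lra.

Import Order.TTheory GRing.Theory Num.Theory.
Import numFieldNormedType.Exports.
Local Open Scope classical_set_scope.
Local Open Scope ring_scope.

(** The upper bound fails because polynomially likely events escape to infinity
in the Skorokhod space.  Call a path xi spread over m+1 points when it takes
m+1 values that are pairwise at distance at least 1/(1+|xi u|) for some time u:
the larger the path, the less its values have to differ.  The set F of these
paths (with an arbitrarily small slack, spread_paths) is closed, since the
condition is stable under time changes and uniform perturbations
(spread_paths_closed).  A step function is bounded, so if it belongs to F it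
takes m+1 distinct values, hence has at least m jumps, and the rate function is
at least min(alpha-1, beta-1) * m on F (rate_spread).

On the other hand the scaled process belongs to F with a probability whose
polynomial order does not depend on m.  It suffices that the increments of X
over the first m unit intervals exceed a constant, which after the division by
n separates the values at the times 0, 1/n, ..., m/n by at least 1/n, and that
the next increment exceeds a multiple of n^2, which makes the scaled path
larger than n (scaled_process_spread).  By independence and stationarity the
cost is a positive constant times P(X(1) >= 2 n^2 + const), and regular
variation of the Levy measure gives this tail a polynomial lower bound along
n = 2^j (levy_tail_geometric).  Taking m large makes the two sides
incompatible.

The tail of X(1) is compared with that of the Levy measure by the principle of
one big jump (levy_big_jump): the presence of an atom of N in
[0,1] x [y,+oo) is independent of the rest of X(1), and the atom adds at least
y to X(1).  The rest is only an almost sure limit of functions of B(1) and of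
finitely many counts of N in disjoint sets; independence holds for these
functions (prm_indep) and survives almost sure limits in the form of an
inequality between probabilities (event_fatou). *)

Set Implicit Arguments.
Unset Strict Implicit.
Unset Printing Implicit Defensive.

(** * Level sets of measurable functions *)

Section level_sets.
Context {R : realType} {d} {T : measurableType d} (f : T -> R).
Hypothesis mf : measurable_fun setT f.

Lemma measurable_gt (r : R) : measurable [set w | r < f w].
Proof.
rewrite -[X in measurable X]setTI.
rewrite (_ : [set w | _] = f @^-1` `]r, +oo[%classic); first exact: mf.
by apply/seteqP; split => w /=; rewrite in_itv/= andbT.
Qed.

Lemma measurable_ge (r : R) : measurable [set w | r <= f w].
Proof.
rewrite -[X in measurable X]setTI.
rewrite (_ : [set w | _] = f @^-1` `[r, +oo[%classic); first exact: mf.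
by apply/seteqP; split => w /=; rewrite in_itv/= andbT.
Qed.

End level_sets.

Lemma measurable_abs_gt (R : realType) (r : R) : measurable [set x : R | r < `|x|].
Proof.
have mn : measurable_fun setT (fun x : R => `|x|) by exact: measurableT_comp.
exact: (measurable_gt mn).
Qed.

(** * A closed set of paths whose values spread out *)

Section spread.
Context {R : realType}.
Implicit Type xi : skorokhod R.

Definition spread_at (k : nat) xi (e : R) (s : 'I_k -> R) (u : R) :=
  forall i j, i != j -> (1 + `|xi u|)^-1 - e <= `|xi (s i) - xi (s j)|.

(** The slack e replaces a supremum over the times, which keeps the set closed
and lets the times be restricted to the rationals. Only values are compared,
not their order in time, so a time change cannot affect membership. *)
Definition spread_paths (k : nat) : set (skorokhod R) :=
  [set xi | forall e, 0 < e -> exists (s : 'I_k -> R) (u : R),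
    [/\ forall i, `[0, 1]%classic (s i), `[0, 1]%classic u & spread_at xi e s u]].

Lemma inv1p_norm_lip (x y : R) : (1 + `|y|)^-1 - `|x - y| <= (1 + `|x|)^-1.
Proof.
have := ler_normD (x - y) y; rewrite subrK => xy.
have x0 := normr_ge0 x; have y0 := normr_ge0 y; have xy0 := normr_ge0 (x - y).
move: xy x0 y0 xy0; move: (`|x|) (`|y|) (`|x - y|) => p q r pq p0 q0 r0.
rewrite lerBlDr -lerBlDl.
have p1 : 0 < 1 + p by lra.
have q1 : 0 < 1 + q by lra.
have -> : (1 + q)^-1 - (1 + p)^-1 = (p - q) / ((1 + q) * (1 + p)).
  by field; rewrite !lt0r_neq0.
rewrite ler_pdivrMr ?mulr_gt0//.
have : 0 <= r * (q + p + q * p) by rewrite mulr_ge0// !addr_ge0// mulr_ge0.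
lra.
Qed.

Lemma spread_paths_closed k : closed (spread_paths k).
Proof.
move=> xi xiF e e0.
(* The slack e is spent as e/2 on membership of the nearby path y, and 3e/6 on
   the two values and on the threshold, each moved by less than e/6. *)
have d0 : 0 < e / 6 by rewrite divr_gt0.
have [y [yF]] := xiF _ (nbhsx_ballx xi _ d0).
move=> /J1_ballP[e' [e'd [l [_ [m [l01 _ _ _ _]]] lP]]].
have [|s [u [s01 u01 su]]] := yF (e / 2); first by rewrite divr_gt0.
exists (l \o s), (l u); split; [by move=> i; exact: l01|exact: l01|].
move=> i j ij; have H := su i j ij.
have [_ Hi] := lP _ (s01 i); have [_ Hj] := lP _ (s01 j); have [_ Hu] := lP _ u01.
have L := inv1p_norm_lip (y u) (xi (l u)).
rewrite distrC in L.
have : `|y (s i) - y (s j)| <= `|xi (l (s i)) - xi (l (s j))| + e' + e'.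
  have -> : y (s i) - y (s j) = (xi (l (s i)) - xi (l (s j)))
      - (xi (l (s i)) - y (s i)) + (xi (l (s j)) - y (s j)) by ring.
  rewrite (le_trans (ler_normD _ _))// lerD// (le_trans (ler_normB _ _))//.
  by rewrite lerD2l.
move=> /= H2; lra.
Qed.

Lemma cadlag_rational xi (s e : R) : `[0, 1]%classic s -> 0 < e ->
  exists q : rat, `[0, 1]%classic (ratr q : R) /\ `|xi (ratr q) - xi s| <= e.
Proof.
move=> s01 e0; have := s01; rewrite /= in_itv/= => /andP[s0].
rewrite le_eqVlt => /predU1P[->|s1].
  exists 1%Q; rewrite rmorph1; split; last by rewrite subrr normr0 ltW.
  by rewrite /= in_itv/= lexx ler01.
have [/cvgrPdist_le/(_ e e0) H _] := skorokhod_cadlag xi s01.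
move: H; rewrite near_withinE near_withinE => -[d /= d0 dP].
have sd : s < Num.min (s + d) 1 by rewrite lt_min s1 ltrDl d0.
have [q] := rat_in_itvoo sd; rewrite in_itv/= lt_min => /andP[sq /andP[qd q1]].
have q01 : `[0, 1]%classic (ratr q : R).
  by rewrite /= in_itv/= (ltW q1) (le_trans s0)// ltW.
exists q; split => //; rewrite distrC; apply: dP => //=.
by rewrite distrC gtr0_norm ?subr_gt0// ltrBlDl.
Qed.

Lemma spread_rational k xi e (s : 'I_k -> R) u : 0 < e ->
  (forall i, `[0, 1]%classic (s i)) -> `[0, 1]%classic u -> spread_at xi e s u ->
  exists v : {ffun 'I_k -> rat} * rat,
   [/\ forall i, `[0, 1]%classic (ratr (v.1 i) : R), `[0, 1]%classic (ratr v.2 : R) &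
    spread_at xi (e + e) (fun i => ratr (v.1 i)) (ratr v.2)].
Proof.
move=> e0 s01 u01 su; have d0 : 0 < e / 3 by rewrite divr_gt0.
have [q [q01 Hq]] := cadlag_rational xi u01 d0.
pose v := [ffun i => projT1 (cid (cadlag_rational xi (s01 i) d0))].
have vP i : `[0, 1]%classic (ratr (v i) : R) /\ `|xi (ratr (v i)) - xi (s i)| <= e / 3.
  by rewrite /v ffunE; case: cid.
exists (v, q); split => //= [i|i j ij]; first by have [] := vP i.
have [_ vi] := vP i; have [_ vj] := vP j; have H := su i j ij.
have L := inv1p_norm_lip (xi u) (xi (ratr q)).
rewrite distrC in L.
have : `|xi (s i) - xi (s j)| <= `|xi (ratr (v i)) - xi (ratr (v j))| + e / 3 + e / 3.
  have -> : xi (s i) - xi (s j) = (xi (ratr (v i)) - xi (ratr (v j)))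
      - (xi (ratr (v i)) - xi (s i)) + (xi (ratr (v j)) - xi (s j)) by ring.
  rewrite (le_trans (ler_normD _ _))// lerD// (le_trans (ler_normB _ _))//.
  by rewrite lerD2l.
move=> H2 /=; lra.
Qed.

(** By right continuity the times may be taken rational at the price of a larger
slack, which turns membership into countably many conditions on evaluations. *)
Lemma spread_paths_measurable k d (T : measurableType d) (Y : T -> skorokhod R) :
  (forall t, `[0, 1]%classic t -> measurable_fun setT (fun w => Y w t)) ->
  measurable (Y @^-1` spread_paths k).
Proof.
move=> mY.
pose ok (v : {ffun 'I_k -> rat} * rat) :=
  (forall i, `[0, 1]%classic (ratr (v.1 i) : R)) /\ `[0, 1]%classic (ratr v.2 : R).
pose A n (v : {ffun 'I_k -> rat} * rat) :=
  [set w | ok v /\ spread_at (Y w) n.+1%:R^-1 (fun i => ratr (v.1 i)) (ratr v.2)].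
rewrite (_ : _ @^-1` _ = \bigcap_n \bigcup_v A n v).
  apply: bigcapT_measurable => n; apply: countable_bigcupT_measurable => // v.
  have [okv|nokv] := pselect (ok v); last first.
    by rewrite (_ : A n v = set0)//; apply/seteqP; split => // w [].
  have [ok1 ok2] := okv.
  (* The inverse is cleared so that the condition is polynomial in the values. *)
  rewrite (_ : A n v = \bigcap_(p in [set: 'I_k * 'I_k]) [set w | p.1 != p.2 ->
     1 <= (`|Y w (ratr (v.1 p.1)) - Y w (ratr (v.1 p.2))| + n.+1%:R^-1) *
       (1 + `|Y w (ratr v.2)|)]); last first.
    have E (x y z : R) : ((1 + `|x|)^-1 - z <= `|y|) = (1 <= (`|y| + z) * (1 + `|x|)).
      by rewrite lerBlDr -[_^-1]mul1r ler_pdivrMr// ltr_pwDl.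
    apply/seteqP; split => [w [_ H] [i j] _ /= ij|w H].
      by rewrite -E; exact: H.
    by split => // i j ij; rewrite E; exact: (H (i, j) I ij).
  apply: fin_bigcap_measurable => // -[i j] _ /=.
  have [ij|ij] := eqVneq i j.
    by rewrite (_ : [set _ | _] = setT)//; apply/seteqP; split.
  have mdiff : measurable_fun setT (fun w =>
      (`|Y w (ratr (v.1 i)) - Y w (ratr (v.1 j))| + n.+1%:R^-1) *
       (1 + `|Y w (ratr v.2)|)).
    apply: measurable_funM; apply: measurable_funD => //.
      by apply: measurableT_comp => //; apply: measurable_funB; exact: mY.
    by apply: measurableT_comp => //; exact: mY.
  rewrite (_ : [set _ | _] = [set w | 1 <= (`|Y w (ratr (v.1 i)) -
    Y w (ratr (v.1 j))| + n.+1%:R^-1) * (1 + `|Y w (ratr v.2)|)]).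
    exact: measurable_ge.
  by apply/seteqP; split => w /=; [exact|move=> + _].
apply/seteqP; split => [w wF n _|w wA e e0].
  have [|s [u [s01 u01 su]]] := wF (n.+1%:R^-1 / 2).
    by rewrite divr_gt0.
  have [|v [v1 v2 v3]] := spread_rational _ s01 u01 su; first by rewrite divr_gt0.
  by exists v => //; split => //; rewrite -splitr in v3.
have [n ne] : exists n : nat, n.+1%:R^-1 <= e.
  exists (Num.bound e^-1); rewrite -[leRHS]invrK lef_pV2 ?posrE ?invr_gt0//.
  have e'0 : 0 <= e^-1 by rewrite invr_ge0 ltW.
  by rewrite (le_trans (ltW (archi_boundP e'0)))// ler_nat.
have [v _ [[v1 v2] v3]] := wA n I.
exists (fun i => ratr (v.1 i)), (ratr v.2); split => // i j ij.
by apply: le_trans (v3 i j ij); rewrite lerD2l lerN2.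
Qed.

End spread.

(** * The rate function on spread paths *)

Section step.
Context {R : realType}.
Implicit Type xi : skorokhod R.

Lemma left_limit_const (f : R -> R) (x y v : R) : x < y ->
  (forall s, x <= s < y -> f s = v) -> left_limit f y = v.
Proof.
move=> xy fv; apply: (@lim_near_cst R) => //.
near=> s; apply: fv; apply/andP; split.
  by near: s; exact: nbhs_left_ge.
by near: s; exact: nbhs_left_lt.
Unshelve. all: by end_near. Qed.

(** A step function only takes its values at the partition points, and each of
them is its initial value or is first reached by a jump: a partition point
without a jump repeats the previous value. *)
Lemma step_values xi : step_function xi -> exists (k : nat) (t : nat -> R),
  [/\ (forall s, `[0, 1]%classic s -> exists2 i, (i <= k)%N & xi s = xi (t i)) &
   forall i, (i <= k)%N -> xi (t i) = xi 0 \/ exists2 r, xi (t i) = xi r &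
     0 < r <= 1 /\ left_limit xi r <> xi r].
Proof.
move=> [k [t [t0 tk H]]]; exists k, t.
have t_ge0 i : (i <= k)%N -> 0 <= t i.
  elim: i => [|i IH] ik; first by rewrite t0.
  by rewrite (le_trans (IH (ltnW ik)))// ltW//; have [] := H i ik.
(* Descending from t k = 1. *)
have t_le1 j : (j <= k)%N -> t (k - j)%N <= 1.
  elim: j => [|j IH] jk; first by rewrite subn0 tk.
  rewrite (le_trans _ (IH (ltnW jk)))// ltW//.
  have [] := H (k - j.+1)%N; first by rewrite ltn_subrL// (leq_trans _ jk).
  by rewrite -subSn// subSS.
split=> [s|].
  rewrite /= in_itv/= => /andP[s0]; rewrite le_eqVlt => /predU1P[->|s1].
    by exists k; rewrite ?tk.
  have exi : exists i, s < t i by exists k; rewrite tk.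
  case: (ex_minnP exi) => -[|i] sti mini; first by rewrite t0 ltNge s0 in sti.
  have ik : (i < k)%N by apply: mini; rewrite tk.
  exists i; first exact: ltnW.
  have [_ ->//] := H i ik; rewrite sti andbT leNgt; apply/negP => /mini.
  by rewrite ltnn.
elim=> [|i IH] ik; first by left; rewrite t0.
have [tii Hi] := H i ik.
have [E|E] := eqVneq (xi (t i.+1)) (xi (t i)); first by rewrite E; apply: IH; exact: ltnW.
right; exists (t i.+1) => //; split.
  rewrite (le_lt_trans (t_ge0 _ (ltnW ik)) tii)/=.
  by have := @t_le1 (k - i.+1)%N; rewrite subKn//; apply; exact: leq_subr.
by rewrite (left_limit_const tii Hi) => /esym/eqP; exact/negP.
Qed.

Lemma step_bounded xi : step_function xi ->
  exists M : R, forall s, `[0, 1]%classic s -> `|xi s| <= M.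
Proof.
move=> /step_values[k [t [H _]]]; exists (\sum_(i < k.+1) `|xi (t i)|) => s /H[i ik ->].
rewrite (bigD1 (Ordinal (ik : (i < k.+1)%N)))//= lerDl; exact: sumr_ge0.
Qed.

(** Every value other than the initial one is reached at some jump time, so there
are at most as many further values as jumps. *)
Lemma step_jumps xi n (v : seq R) : step_function xi -> size v = n.+1 ->
  uniq v -> (forall x, x \in v -> exists2 s, `[0, 1]%classic s & x = xi s) ->
  (n%:R%:E <= upward_jumps xi + downward_jumps xi)%E.
Proof.
move=> /step_values[k [t [H1 H2]]] sv uv vP.
rewrite /upward_jumps /downward_jumps.
set U := [set t0 | _]; set D := [set t0 | _ /\ xi t0 < _].
rewrite /counting; case: asboolP => [finU|_]; last by case: asboolP => _; rewrite ?addye// leey.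
case: asboolP => [finD|_]; last by rewrite addey// leey.
rewrite -EFinD -natrD lee_fin ler_nat.
have : {subset v <= xi 0 ::
    [seq xi r | r <- finmap.enum_fset (fset_set U) ++ finmap.enum_fset (fset_set D)]}.
  move=> x /vP[s /H1[i ik ->] ->]; have [->|[r ->]] := H2 i ik; first exact: mem_head.
  move=> [r01 /eqP]; rewrite inE => rjump; apply/orP; right.
  apply: map_f; rewrite mem_cat !in_fset_set//.
  move: rjump; rewrite neq_lt => /orP[rU|rD]; apply/orP; [left|right]; apply/mem_set.
    by split.
  by split.
move=> /(uniq_leq_size uv); rewrite sv /= size_map size_cat.
by rewrite ltnS.
Qed.

(** If M bounds a step function, the threshold never falls below 1/(1+M), so half
of this as slack already forces the n+1 values to be distinct. *)
Lemma rate_spread (alpha beta : R) n xi : 1 < alpha -> 1 < beta ->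
  spread_paths n.+1 xi ->
  ((Num.min (alpha - 1) (beta - 1) * n%:R)%:E <= rate_I alpha beta xi)%E.
Proof.
move=> a1 b1 xiS; rewrite /rate_I; case: asboolP => [[xistep _]|_]; last exact: leey.
have [M HM] := step_bounded xistep.
have M0 : 0 <= M by apply: (le_trans (normr_ge0 (xi 0))); apply: HM; rewrite /= in_itv/= lexx ler01.
have M1 : 0 < 1 + M by rewrite ltr_pwDl.
have [|s [u [s01 u01 su]]] := xiS ((1 + M)^-1 / 2).
  by rewrite divr_gt0// invr_gt0.
have jumps : (n%:R%:E <= upward_jumps xi + downward_jumps xi)%E.
  apply: (step_jumps (v := [seq xi (s i) | i <- enum 'I_n.+1])) => //.
  - by rewrite size_map size_enum_ord.
  - rewrite map_inj_uniq ?enum_uniq// => i j; apply: contra_eq => ij.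
    rewrite -subr_eq0 -normr_gt0; apply: lt_le_trans (su i j ij).
    rewrite subr_gt0 (@lt_le_trans _ _ (1 + M)^-1)//.
      by rewrite ltr_pdivrMr// ltr_pMr ?invr_gt0// ltr1n.
    by rewrite lef_pV2 ?posrE ?lerD2l ?HM// ltr_pwDl.
  - by move=> x /mapP[i _ ->]; exists (s i).
have U0 : (0 <= upward_jumps xi)%E by exact: measure_ge0.
have D0 : (0 <= downward_jumps xi)%E by exact: measure_ge0.
set mu := Num.min _ _.
have mu0 : 0 < mu by rewrite lt_min !subr_gt0 a1.
apply: (@le_trans _ _ (mu%:E * (upward_jumps xi + downward_jumps xi))%E).
  by rewrite EFinM; apply: lee_wpmul2l => //; rewrite lee_fin ltW.
rewrite ge0_muleDr//; apply: leeD; apply: lee_wpmul2r => //; rewrite lee_fin.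
  by rewrite ge_min lexx.
by rewrite ge_min lexx orbT.
Qed.

End step.

(** * Limits and independence of events *)

Section events.
Context {R : realType} {d} {T : measurableType d} (P : probability T R).
Local Open Scope ereal_scope.

Lemma indep_bigcup (H : nat -> set T) (G : set T) :
  (forall i, measurable (H i)) -> trivIset setT H -> measurable G ->
  (forall i, P (H i `&` G) = P (H i) * P G) ->
  P (\bigcup_i H i `&` G) = P (\bigcup_i H i) * P G.
Proof.
move=> mH tH mG HG; rewrite setI_bigcupl !measure_bigcup//; first last.
- exact: trivIset_setIr.
- by move=> i _; exact: measurableI.
- rewrite (@eq_eseriesr _ _ (fun i => P (H i) * P G)); last by move=> i _; exact: HG.
  rewrite (_ : P G = (fine (P G))%:E); last by rewrite fineK// fin_num_measure.
  under eq_eseriesr => i _ do rewrite muleC.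
  by rewrite nneseriesZl// muleC.
Qed.

(** If U is an almost sure limit of U_j, then U > r entails U_j > r eventually,
and U_j >= r infinitely often entails U >= r; with H_j the event U_j > r and
H'_j the event that U_j >= r and G holds, this carries the inequality
P(U > r) P(G) <= P(U >= r and G), a weak form of independence, to the limit. *)
Lemma event_fatou (N0 E E' : set T) (H H' : nat -> set T) (g : R) :
  P.-negligible N0 -> measurable E -> measurable E' ->
  (forall j, measurable (H j)) -> (forall j, measurable (H' j)) ->
  (forall j, P (H j) * g%:E <= P (H' j)) ->
  (forall w, ~ N0 w -> E w -> \forall j \near \oo, H j w) ->
  (forall w, ~ N0 w -> (forall n, exists2 j, (n <= j)%N & H' j w) -> E' w) ->
  P E * g%:E <= P E'.
Proof.
move=> [N [mN PN N0N]] mE mE' mH mH' HH' EH HE'.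
have [g0|g0] := ltP g 0%R.
  by apply: (@le_trans _ _ 0) => //; rewrite mule_ge0_le0// lee_fin ltW.
pose A n := \bigcap_(j in [set j | (n <= j)%N]) H j.
pose A' n := \bigcup_(j in [set j | (n <= j)%N]) H' j.
have mA n : measurable (A n) by apply: bigcap_measurableType => j _.
have mA' n : measurable (A' n) by apply: bigcup_measurable => j _.
have mUA : measurable (\bigcup_n A n) by apply: bigcupT_measurable.
have mIA' : measurable (\bigcap_n A' n) by apply: bigcapT_measurable.
have cA : P \o A @ \oo --> P (\bigcup_n A n).
  apply: nondecreasing_cvg_mu => // m n mn; apply/subsetPset => w Am j /= nj.
  by apply: Am => /=; exact: leq_trans nj.
have cA' : P \o A' @ \oo --> P (\bigcap_n A' n).
  apply: nonincreasing_cvg_mu => //; first by rewrite -ge0_fin_numE// fin_num_measure.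
  move=> m n mn; apply/subsetPset => w [j /= nj Hj].
  by exists j => //=; exact: leq_trans nj.
have EA : P E <= P (\bigcup_n A n).
  apply: (@le_trans _ _ (P (\bigcup_n A n `|` N))).
    apply: le_measure; rewrite ?inE//; first exact: measurableU.
    move=> w Ew; have [Nw|Nw] := pselect (N w); [by right|left].
    have [n _ nH] := EH w (fun h => Nw (N0N _ h)) Ew.
    by exists n.
  by rewrite measureU0.
have EA' : P (\bigcap_n A' n) <= P E'.
  apply: (@le_trans _ _ (P (E' `|` N))).
    apply: le_measure; rewrite ?inE//; first exact: measurableU.
    move=> w Aw; have [Nw|Nw] := pselect (N w); [by right|left].
    apply: HE' => [|n]; first by move=> /N0N.
    by have [j /= nj Hj] := Aw n I; exists j.
  by rewrite measureU0.
apply: (@le_trans _ _ (P (\bigcup_n A n) * g%:E)).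
  by apply: lee_wpmul2r; rewrite ?lee_fin.
apply: le_trans EA'.
rewrite -(cvg_lim _ cA')//.
have cAg : (P \o A) n * g%:E @[n --> \oo] --> P (\bigcup_n A n) * g%:E.
  exact: cvgeZr.
rewrite -(cvg_lim _ cAg)//; apply: lee_lim.
- by apply/cvg_ex; exists (P (\bigcup_n A n) * g%:E).
- by apply/cvg_ex; exists (P (\bigcap_n A' n)).
apply: nearW => n /=; apply: (@le_trans _ _ (P (H n) * g%:E)).
  apply: lee_wpmul2r; rewrite ?lee_fin//; apply: le_measure; rewrite ?inE//.
  by move=> w; apply => /=.
apply: le_trans (HH' n) _; apply: le_measure; rewrite ?inE//.
by move=> w Hw; exists n => /=.
Qed.

End events.

(** * Poisson random measures *)

Section poisson_law.
Context {R : realType} {d} {T : measurableType d} (P : probability T R).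
Context {d'} {E : measurableType d'} (mu : set E -> \bar R)
  (N : T -> {measure set E -> \bar R}).
Hypothesis prm : poisson_random_measure P mu N.
Variable A : set E.
Hypothesis mA : measurable A.
Hypothesis muA : (0 <= mu A < +oo)%E.
Local Open Scope ereal_scope.

Lemma prm_neq0 : P [set w | N w A != 0] = (1 - expR (- fine (mu A)))%:E.
Proof.
have [_ mN + _ _] := prm => /(_ A 0%N mA); move: muA => /andP[_ muy] /(_ muy).
rewrite /= expr0 fact0 mulr1 divr1 => PN.
have -> : [set w | N w A != 0] = ~` [set w | N w A = 0].
  by apply/seteqP; split => w /= /eqP.
rewrite probability_setC.
  by rewrite PN EFinB.
by rewrite -[X in measurable X]setTI; apply: (mN A mA measurableT [set 0]).
Qed.

(** The Poisson weights add up to 1, which leaves no mass for the value +oo. *)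
Lemma prm_fin : P [set w | N w A = +oo] = 0.
Proof.
have [Nk mN PN _ _] := prm.
have mE x : measurable [set w | N w A = x].
  by rewrite -[X in measurable X]setTI; apply: (mN A mA measurableT [set x]).
have muA0 : (0 <= fine (mu A))%R by rewrite fine_ge0//; case/andP: muA.
have PU : P (\bigcup_k [set w | N w A = k%:R%:E]) = 1.
  rewrite measure_semi_bigcup//; last exact: bigcupT_measurable; last first.
    by move=> i j _ _ [w [/= ->]] [] /eqP; rewrite eqr_nat => /eqP.
  have sumE : \sum_(k <oo) (fine (mu A) ^+ k / k`!%:R)%:E = (expR (fine (mu A)))%:E.
    have ce := is_cvg_series_exp_coeff (fine (mu A)).
    have -> : (expR (fine (mu A)))%:E = (limn (series (exp_coeff (fine (mu A)))))%:E by [].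
    rewrite -EFin_lim//.
    by apply/congr_lim/funext => n/=; rewrite /series/= -sumEFin.
  transitivity (\sum_(k <oo)
    ((expR (- fine (mu A)))%:E * (fine (mu A) ^+ k / k`!%:R)%:E)).
    apply: eq_eseriesr => k _.
    by rewrite /= PN// -?EFinM ?mulrA//; case/andP: muA.
  rewrite nneseriesZl; last by move=> n _; rewrite lee_fin divr_ge0// exprn_ge0.
  by rewrite sumE -EFinM expRN mulVf// gt_eqF// expR_gt0.
have -> : [set w | N w A = +oo] = ~` \bigcup_k [set w | N w A = k%:R%:E].
  apply/seteqP; split => [w /= Noo [k _ /=]|w /= NU]; first by rewrite Noo.
  by have [//|[k Nwk]] := Nk w A mA; case: NU; exists k.
rewrite probability_setC ?PU ?subee//; exact: bigcupT_measurable.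
Qed.

End poisson_law.

Section poisson_independence.
Context {R : realType} {d} {T : measurableType d} (P : probability T R).
Context {d'} {E : measurableType d'} (mu : set E -> \bar R)
  (N : T -> {measure set E -> \bar R}).
Hypothesis prm : poisson_random_measure P mu N.
Local Open Scope ereal_scope.

Lemma sigma_generatedP (D : set (set E)) A (C : set (\bar R)) : D A ->
  measurable C -> sigma_generated D (fun A w => N w A) [set w | C (N w A)].
Proof. by move=> DA mC; apply: sub_gen_smallest; exists A => //; exists C. Qed.

Lemma prm_preimage_measurable A (C : set (\bar R)) : measurable A ->
  measurable C -> measurable [set w | C (N w A)].
Proof.
move=> mA mC; have [_ mN _ _ _] := prm.
by rewrite -[X in measurable X]setTI; exact: mN.
Qed.

Lemma prm_fine_nat w A : measurable A -> exists n : nat, fine (N w A) = n%:R%R.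
Proof.
move=> mA; have [+ _ _ _ _] := prm => /(_ w A mA)[->|[n ->]]; last by exists n.
by exists 0%N.
Qed.

Variables (k : nat) (A : 'I_k -> set E) (A0 : set E).
Hypothesis mA : forall i, measurable (A i).
Hypothesis mA0 : measurable A0.
Hypothesis tA : trivIset setT A.
Hypothesis A0A : forall i, A i `&` A0 = set0.

Lemma prm_mutual C0 (C : 'I_k -> set (\bar R)) : measurable C0 ->
  (forall i, measurable (C i)) ->
  P ([set w | C0 (N w A0)] `&` [set w | forall i, C i (N w (A i))]) =
  P [set w | C0 (N w A0)] * \prod_(i < k) P [set w | C i (N w (A i))].
Proof.
move=> mC0 mC; have [_ _ _ _ /(_ k.+1)] := prm.
pose A' (i : 'I_k.+1) := if unlift ord0 i is Some j then A j else A0.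
pose C' (i : 'I_k.+1) := if unlift ord0 i is Some j then C j else C0.
move=> /(_ A') H0; have /H0 H1 : forall i, measurable (A' i).
  by move=> i; rewrite /A'; case: unlift.
have : trivIset setT A'.
  move=> i j _ _; rewrite /A'.
  case: (unliftP ord0 i) => [i' ->|->]; case: (unliftP ord0 j) => [j' ->|->] //.
  - by move=> H; congr lift; exact: tA H.
  - by rewrite A0A => -[].
  - by rewrite setIC A0A => -[].
move=> /H1 /(_ C') H2.
have /H2 : forall i, measurable (C' i) by move=> i; rewrite /C'; case: unlift.
rewrite big_ord_recl /C' /A' unlift_none => H.
under [in RHS]eq_bigr => i _.
  rewrite (_ : [set w | C i (N w (A i))] = (fun w => N w
    (if unlift ord0 (lift ord0 i) is Some j then A j else A0)) @^-1`
    (if unlift ord0 (lift ord0 i) is Some j then C j else C0)); last by rewrite liftK.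
  over.
rewrite -H; congr (P _); apply/seteqP; split => [w [w0 wC] i _ /=|w wC].
  by case: (unliftP ord0 i) => [j _|_] /=; [exact: wC|exact: w0].
split => [|i].
  by have := wC ord0 I; rewrite /= unlift_none.
by have := wC (lift ord0 i) I; rewrite /= liftK.
Qed.

Context (G0 : set (set T)) (V : T -> R) (c : 'I_k -> R).
Hypothesis mG0 : forall r : R, measurable [set w | (r < V w)%R].
Hypothesis VG0 : forall r : R, G0 [set w | (r < V w)%R].
Hypothesis iG0 : independent_sigma P G0
  (sigma_generated measurable (fun A w => N w A)).

Let S w := (V w + \sum_(i < k) c i * fine (N w (A i)))%R.
Let G := [set w | N w A0 != 0].

Lemma measurable_fine_eq (r : R) : measurable [set x : \bar R | fine x = r].
Proof.
rewrite -[X in measurable X]setTI.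
by apply: (@fine_measurable R setT measurableT _ [set r]).
Qed.

Lemma measurable_neq0 : measurable [set x : \bar R | x != 0].
Proof.
rewrite (_ : [set _ | _] = ~` [set 0]); first exact: measurableC.
by apply/seteqP; split => x /eqP.
Qed.

(** The counts take countably many values, and on the event that they are given
the condition on the sum only concerns V; the probability of each piece
factorizes. *)
Lemma prm_indep r : P ([set w | (r < S w)%R] `&` G) =
   P [set w | (r < S w)%R] * P G.
Proof.
pose C (v : {ffun 'I_k -> nat}) i := [set x : \bar R | fine x = (v i)%:R%R].
have mC v i : measurable (C v i) by exact: measurable_fine_eq.
pose r' (v : {ffun 'I_k -> nat}) := (r - \sum_(i < k) c i * (v i)%:R)%R.
pose tau v := [set w | forall i, C v i (N w (A i))].
pose H j := if @pickle_inv {ffun 'I_k -> nat} j is Some v then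
    [set w | (r' v < V w)%R] `&` tau v else set0.
have mG : measurable G by exact: (prm_preimage_measurable mA0 measurable_neq0).
have tauE v : tau v = \big[setI/setT]_(i < k) [set w | C v i (N w (A i))].
  rewrite -bigcap_seq.
  apply/seteqP; split => [w wt i _|w wt i]; first exact: wt.
  by apply: wt; rewrite /= mem_index_enum.
have mtau v : measurable (tau v).
  rewrite tauE; apply: (@big_ind _ (fun X : set T => measurable X)) => [|X Y|i _].
  - exact: measurableT.
  - exact: measurableI.
  - exact: (prm_preimage_measurable (mA i) (mC v i)).
have HE : [set w | (r < S w)%R] = \bigcup_j H j.
  apply/seteqP; split => [w /= rS|w [j _]].
    have nat_i i : exists n : nat, fine (N w (A i)) = n%:R%R by exact: prm_fine_nat.
    pose v := [ffun i => projT1 (cid (nat_i i))].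
    have vE i : fine (N w (A i)) = (v i)%:R%R.
      by rewrite /v ffunE; case: cid.
    exists (pickle v) => //; rewrite /H pickleK_inv; split => //=.
    rewrite /r' ltrBlDr; move: rS; rewrite /S.
    by under eq_bigr do rewrite vE.
  rewrite /H; case: pickle_inv => // v [/= + tw].
  rewrite /r' ltrBlDr /S; under eq_bigr do rewrite -tw.
  by [].
(* The pieces are indexed by nat through the pickling of finite functions; an
   index that encodes no function gives the empty event. *)
rewrite HE; apply: indep_bigcup => //.
- move=> j; rewrite /H; case: pickle_inv => // v; exact: measurableI.
- move=> i j _ _; rewrite /H.
  have := @pickle_invK {ffun 'I_k -> nat} i; have := @pickle_invK {ffun 'I_k -> nat} j.
  case: pickle_inv => [u|] /=; last by rewrite setI0 => _ _ [].
  case: pickle_inv => [v|] /=; last by rewrite set0I => _ _ [].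
  move=> <- <- [w [[_ vw] [_ uw]]]; congr pickle.
  by apply/ffunP => l; apply/eqP; rewrite -(eqr_nat R) -vw -uw.
move=> j; rewrite /H; case: pickle_inv => [v|]; last by rewrite set0I measure0 mul0e.
have mut := prm_mutual _ (mC v).
have Stau : sigma_generated measurable (fun A w => N w A) (tau v).
  rewrite tauE; apply: (@bigsetI_measurable _ (g_sigma_algebraType _)) => i _.
  exact: (sigma_generatedP (mA i) (mC v i)).
have StauG : sigma_generated measurable (fun A w => N w A) (tau v `&` G).
  apply: (@measurableI _ (g_sigma_algebraType _)) => //.
  exact: (sigma_generatedP mA0 measurable_neq0).
rewrite -setIA (iG0 (VG0 _) StauG) (iG0 (VG0 _) Stau) -muleA; congr (_ * _).
have := mut _ measurable_neq0; rewrite setIC -/(tau v) -/G => ->.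
have := mut _ measurableT; rewrite setTI -/(tau v) => ->.
by rewrite (_ : [set w | _] = setT) ?probability_setT ?mul1e 1?muleC//.
Qed.

End poisson_independence.

(** * Integrals against integer-valued measures *)

Section integer_measure.
Context {R : realType} {d} {E : measurableType d} (M : {measure set E -> \bar R}).
Hypothesis intM : forall A, measurable A ->
  M A = +oo%E \/ exists k : nat, M A = k%:R%:E.
Variables (D : set E) (f : E -> R).
Hypothesis mD : measurable D.
Hypothesis MD : (M D < +oo)%E.
Hypothesis mf : measurable_fun setT f.

Lemma measurable_tail p : measurable [set x | p <= `|f x|].
Proof.
have mn : measurable_fun setT (fun x => `|f x|) by exact: measurableT_comp.
exact: (measurable_ge mn).
Qed.

(** The measures of these sets decrease to 0, and an integer below 1 is 0. *)
Lemma integer_measure_tail : exists p0 : nat, forall p, (p0 <= p)%N ->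
  M (D `&` [set x | p%:R <= `|f x|]) = 0%E.
Proof.
pose F p := D `&` [set x | p%:R <= `|f x|].
have mF p : measurable (F p).
  by apply: measurableI => //; exact: measurable_tail.
have niF : nonincreasing_seq F.
  move=> m n mn; apply/subsetPset => x [Dx /= nf]; split => //=.
  by apply: le_trans nf; rewrite ler_nat.
have F0 : \bigcap_n F n = set0.
  apply/seteqP; split => // x Fx.
  have [_ /=] := Fx (Num.bound `|f x|) I.
  by rewrite leNgt archi_boundP.
have FD p : (M (F p) <= M D)%E by apply: le_measure; rewrite ?inE// => x [].
have := @nonincreasing_cvg_mu _ _ _ M F (le_lt_trans (FD _) MD) mF.
rewrite F0 measure0 => /(_ measurable0 niF) cF.
have /cF[n _ nF] : nbhs (0%E : \bar R) [set y | (y < 1%:E)%E].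
  apply: open_nbhs_nbhs; split; first exact: open_ereal_lt_ereal.
  by rewrite /= lte_fin.
exists n => p np; have /= := nF p np.
case: (intM (mF p)) => [->//|[[|k] ->//]].
by rewrite lte_fin ltrn1.
Qed.

(** The function is bounded outside a null set and the measure is finite. *)
Lemma integer_measure_integrable : M.-integrable D (EFin \o f).
Proof.
have [p /(_ p (leqnn p))] := integer_measure_tail.
set D0 := _ `&` _ => MD0.
have mD0 : measurable D0.
  by apply: measurableI => //; exact: measurable_tail.
have mfD : measurable_fun D (EFin \o f).
  by apply/measurable_EFinP; exact: measurable_funS mf.
apply/(negligible_integrable mD0 mD mfD MD0).
apply: measurable_bounded_integrable => //.
- exact: measurableD.
- by apply: le_lt_trans MD; apply: le_measure; rewrite ?inE//; exact: measurableD.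
- by apply: measurable_funS mf.
exists p%:R; split => // r pr x /= [Dx nD0x].
rewrite (le_trans _ (ltW pr))// leNgt; apply/negP => pf; apply: nD0x; split => //=.
exact: ltW.
Qed.

(** The part of D on which f is in the i-th of the intervals of length 1/q
starting from -q; the first 2 q^2 of them cover [-q, q[. *)
Definition grid_cell (q i : nat) : set E :=
  D `&` [set x | i%:R - q%:R ^+ 2 <= q%:R * f x < i.+1%:R - q%:R ^+ 2].

Lemma measurable_grid_cell q i : measurable (grid_cell q i).
Proof.
apply: measurableI => //; rewrite -[X in measurable X]setTI.
rewrite (_ : [set x | _] = (fun x => q%:R * f x) @^-1`
   `[i%:R - q%:R ^+ 2, i.+1%:R - q%:R ^+ 2[%classic).
  by apply: (measurable_funM (measurable_cst _) mf) => //; exact: measurable_itv.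
by apply/seteqP; split => x /=; rewrite in_itv/=.
Qed.

Lemma trivIset_grid_cell q : trivIset setT (grid_cell q).
Proof.
move=> i j _ _ [x [[_ /= /andP[a b]] [_ /andP[c e]]]].
have ij : (i < j.+1)%N by rewrite -(ltr_nat R) -(ltrD2r (- q%:R ^+ 2)) (le_lt_trans a e).
have ji : (j < i.+1)%N by rewrite -(ltr_nat R) -(ltrD2r (- q%:R ^+ 2)) (le_lt_trans c b).
by apply/eqP; rewrite eqn_leq -ltnS ij -ltnS ji.
Qed.

(** Once q exceeds |f| outside a null set, replacing f by the left end of its
interval costs at most 1/q per unit of mass. *)
Lemma grid_approx : exists p0 : nat, forall q, (p0 <= q)%N -> (0 < q)%N ->
  `|\int[M]_(x in D) f x -
    \sum_(i < 2 * q ^ 2) (i%:R - q%:R ^+ 2) / q%:R * fine (M (grid_cell q i))|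
  <= fine (M D) / q%:R.
Proof.
have [p0 p0P] := integer_measure_tail; exists p0 => q p0q q0.
have q0R : 0 < q%:R :> R by rewrite ltr0n.
set K := (2 * q ^ 2)%N.
pose B := \big[setU/set0]_(i < K) grid_cell q i.
have mB : measurable B by apply: bigsetU_measurable => i _; exact: measurable_grid_cell.
have BD : B `<=` D by rewrite /B -bigcup_mkord => x [i _ []].
have intD := integer_measure_integrable.
have MBD : (M (D `\` B) = 0)%E.
  apply/eqP; rewrite eq_le measure_ge0 andbT -(p0P q p0q).
  apply: le_measure; rewrite ?inE.
  - exact: measurableD.
  - by apply: measurableI => //; exact: measurable_tail.
  move=> x [Dx nBx]; split => //=; rewrite leNgt; apply/negP => fq; apply: nBx.
  move: fq; rewrite ltr_norml => /andP[f1 f2].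
  pose y := q%:R * f x + q%:R ^+ 2.
  have y0 : 0 <= y by rewrite /y; nra.
  have y2 : y < K%:R by rewrite /K natrM natrX /y; nra.
  have /andP[ty yt] := truncn_itv y0.
  have tK : (Num.truncn y < K)%N by rewrite -(ltr_nat R) (le_lt_trans ty).
  rewrite /B -bigcup_mkord; exists (Num.truncn y) => //; split => //=.
  by rewrite lerBlDr ltrBrDr -/y ty yt.
have MDfin : M D \is a fin_num by rewrite ge0_fin_numE.
have Mcell i : M (grid_cell q i) \is a fin_num.
  rewrite ge0_fin_numE// (le_lt_trans _ MD)//; apply: le_measure; rewrite ?inE//.
    exact: measurable_grid_cell.
  by move=> x [].
have icell i : M.-integrable (grid_cell q i) (EFin \o f).
  by apply: integrableS intD => //; [exact: measurable_grid_cell|move=> x []].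
have intDB : \int[M]_(x in D) f x = \sum_(i < K) \int[M]_(x in grid_cell q i) f x.
  rewrite /Rintegral (negligible_integral _ _ _ MBD)//; last exact: measurableD.
  rewrite setDD setIidr// /B -(big_mkord xpredT) integral_bigsetU_EFin//.
  - rewrite -(big_mkord xpredT (fun i => fine (\int[M]_(x in grid_cell q i) (f x)%:E))).
    rewrite (eq_bigr (fun i => (fine (\int[M]_(x in grid_cell q i) (f x)%:E))%:E)).
      by rewrite sumEFin.
    by move=> i _; rewrite fineK//; apply: integrable_fin_num => //; exact: measurable_grid_cell.
  - exact: measurable_grid_cell.
  - exact: iota_uniq.
  - exact: sub_trivIset (@trivIset_grid_cell q).
  - by apply/measurable_EFinP; exact: measurable_funS mf.
have sumM : \sum_(i < K) fine (M (grid_cell q i)) <= fine (M D).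
  rewrite -lee_fin fineK// -sumEFin; under eq_bigr do rewrite fineK//.
  rewrite -(@measure_semi_additive _ _ _ M (grid_cell q)).
  - by apply: le_measure; rewrite ?inE.
  - exact: measurable_grid_cell.
  - exact: trivIset_grid_cell.
  - by [].
rewrite intDB -sumrB; apply: (le_trans (ler_norm_sum _ _ _)).
apply: (@le_trans _ _ (\sum_(i < K) q%:R^-1 * fine (M (grid_cell q i)))); last first.
  by rewrite -mulr_sumr mulrC ler_pM2r// invr_gt0.
apply: ler_sum => i _.
have mc := @measurable_grid_cell q i.
have icst r : M.-integrable (grid_cell q i) (EFin \o cst r).
  apply: measurable_bounded_integrable => //; first by rewrite -ge0_fin_numE.
  by exists `|r|; split => // s rs x _ /=; exact: ltW.
rewrite -(Rintegral_cst M mc) -(Rintegral_cst M mc) -RintegralB//.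
apply: (le_trans (le_normr_Rintegral _ _)) => //.
  by apply: (integrableB mc (icell i) (icst _)).
apply: le_Rintegral => //.
  have := integrable_norm (integrableB mc (icell i) (icst _)); exact.
  exact: icst.
move=> x [_ /= /andP[a b]].
rewrite ler_norml; apply/andP; split.
  rewrite (@le_trans _ _ 0)// ?oppr_le0 ?invr_ge0// subr_ge0 ler_pdivrMr// mulrC//.
rewrite lerBlDl -[X in _ + X]mul1r -mulrDl ler_pdivlMr// mulrC (le_trans (ltW b))//.
  by rewrite -natr1 addrAC.
exact: icst.
Qed.

End integer_measure.

(** * The intensity of the jumps *)

Section intensity.
Context {R : realType} (nu : {measure set R -> \bar R}).
Local Open Scope ereal_scope.

Lemma jump_intensity_slab (S : set R) : measurable S ->
  jump_intensity nu (`[0%R, 1%R] `*` S) = nu S.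
Proof.
move=> mS; rewrite /jump_intensity /product_measure1.
rewrite (_ : _ `&` _ = `[0%R, 1%R] `*` S); last first.
  apply/seteqP; split => [x [] //|x [x1 x2]]; split => //; split => //=.
  by move: x1; rewrite /= !in_itv/= andbT => /andP[].
transitivity (\int[@lebesgue_measure R]_x
    ((\1_(`[0%R, 1%R]%classic : set R) x)%:E * nu S)).
  apply: eq_integral => x _ /=; rewrite indicE; have [x01|x01] := boolP (x \in _).
    by rewrite in_xsectionX// mul1e.
  by rewrite notin_xsectionX// measure0 mul0e.
rewrite ge0_integralZr//; last by apply/measurable_EFinP.
rewrite integral_indic// setIT.
rewrite [X in X * _](_ : _ = 1) ?mul1e//.
by have := @lebesgue_measure_itv R `[0%R, 1%R]; rewrite /= lte_fin ltr01 oppr0 adde0.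
Qed.

Hypothesis levynu : levy_measure nu.

(** On this set the integrand min(1, x^2) is at least min(1, h^2). *)
Lemma levy_measure_fin (h : R) : (0 < h)%R ->
  nu [set x | (h < `|x|)%R] < +oo.
Proof.
move=> h0; have [_ inu] := levynu.
have mS := @measurable_abs_gt R h.
have mm : measurable_fun setT (fun x : R => (Num.min 1 (x ^+ 2))%:E).
  apply/measurable_EFinP; apply: measurable_minr => //.
have c0 : (0 < Num.min 1 (h ^+ 2))%R by rewrite lt_min ltr01 exprn_gt0.
have : (Num.min 1 (h ^+ 2))%:E * nu [set x | (h < `|x|)%R] < +oo.
  apply: le_lt_trans inu; rewrite -integral_cst//.
  apply: (@le_trans _ _ (\int[nu]_(x in [set x | (h < `|x|)%R]) (Num.min 1 (x ^+ 2))%:E)).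
    apply: ge0_le_integral => //.
    - by move=> x _; rewrite lee_fin ltW.
    - by apply: measurable_funS mm.
    move=> x /= hx; rewrite lee_fin le_min ge_min lexx /= ge_min; apply/orP; right.
    by rewrite -(real_normK (num_real x)) lerXn2r ?nnegrE// ltW.
  apply: ge0_subset_integral => //.
  by move=> x _; rewrite lee_fin le_min ler01 sqr_ge0.
rewrite ltey => h1; rewrite ltey; apply: contra_neq h1 => ->.
by rewrite gt0_muley// lte_fin.
Qed.

End intensity.

(** * One big jump of the Levy process *)

Section big_jump.
Context {R : realType} {d} {T : measurableType d} (P : probability T R).
Context (nu : {measure set R -> \bar R}) (a sigma : R) (X : T -> R -> R)
  (B : T -> R -> R) (N : T -> {measure set (R * R) -> \bar R}).
Hypothesis nuL : levy_measure nu.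
Hypothesis mX : measurable_fun setT (X ^~ 1).
Hypothesis XI : ito_representation P X a sigma B N nu.

Local Notation slab S := (`[0, 1]%classic `*` S : set (R * R)).

Let prm : poisson_random_measure P (jump_intensity nu) N.
Proof. by have [] := XI. Qed.

Let intN w A : measurable A -> N w A = +oo%E \/ exists k : nat, N w A = k%:R%:E.
Proof. by have [+ _ _ _ _] := prm => H; exact: H. Qed.

Let mB : measurable_fun setT (B ^~ 1).
Proof. by have [[+ _ _ _ _] _ _ _] := XI => /(_ 1 ler01). Qed.

Let mslab S : measurable S -> measurable (slab S).
Proof. by move=> mS; apply: measurableX. Qed.

Let h (j : nat) : R := j.+1%:R^-1.
Let h0 j : 0 < h j. Proof. by rewrite invr_gt0. Qed.
Let h1 j : h j <= 1. Proof. by rewrite invf_le1// ler1n. Qed.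

Let big j := slab [set x | h j < `|x|].

Let mbig j : measurable (big j).
Proof. by apply: mslab; exact: measurable_abs_gt. Qed.

Let N_big_fin : P.-negligible [set w | exists j, N w (big j) = +oo%E].
Proof.
rewrite (_ : [set w | _] = \bigcup_j [set w | N w (big j) = +oo%E]); last first.
  by apply/seteqP; split => [w [j ?]|w [j _ ?]]; exists j.
apply: negligible_bigcup => j.
exists [set w | N w (big j) = +oo%E]; split => //.
  have [_ mN _ _ _] := prm.
  rewrite -[X in measurable X]setTI.
  exact: (mN (big j) (mbig j) measurableT [set +oo%E]).
apply: (prm_fin prm) => //; rewrite jump_intensity_slab; last exact: measurable_abs_gt.
by rewrite measure_ge0 levy_measure_fin.
Qed.

Variable y : R.
Hypothesis y1 : 1 < y.

Let G := [set w | N w (slab `[y, +oo[%classic) != 0%E].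

(** The atoms that are independent of the event G of a jump of size at least y. *)
Let low j := slab [set x | h j < `|x| /\ x < y].

Let mlow j : measurable (low j).
Proof.
apply: mslab; apply: measurableI; first exact: measurable_abs_gt.
rewrite (_ : (fun _ => _) = `]-oo, y[%classic)//.
Qed.

Let mA0 : measurable (slab `[y, +oo[%classic). Proof. exact: mslab. Qed.

Let mG : measurable G.
Proof. exact: (prm_preimage_measurable prm mA0 (@measurable_neq0 R)). Qed.

Let b j := a - \int[nu]_(x in [set x | h j < `|x| <= 1]) x.

(** The part of X(1) carried by B and by the atoms in low j, with the compensator
subtracted; it converges to X(1) minus the sum of the jumps of size at least y.
Where the count is infinite it is set to 0, which keeps it measurable. *)
Let U j w := if N w (low j) == +oo%E then 0 else
  B w 1 + b j + \int[N w]_(z in low j) z.2.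

(** The same with the integral replaced by its grid sums, which only involve B(1)
and the counts of N in finitely many disjoint cells. *)
Let S j q w := B w 1 + b j + \sum_(i < 2 * q ^ 2)
   (i%:R - q%:R ^+ 2) / q%:R * fine (N w (grid_cell (low j) snd q i)).

Let S_cvg j w : (N w (low j) < +oo)%E -> S j q w @[q --> \oo] --> U j w.
Proof.
move=> Nfin; rewrite /U lt_eqF//; apply: cvgD; first exact: cvg_cst.
have [p0 H] := @grid_approx R _ _ (N w) (intN w) (low j) snd (mlow j) Nfin
  measurable_snd.
apply/cvgrPdist_le => e e0; near=> q.
apply: (le_trans (H q _ _)); [by near: q; exact: nbhs_infty_ge|
  by near: q; exact: nbhs_infty_gt|].
rewrite ler_pdivrMr; last by rewrite ltr0n; near: q; exact: nbhs_infty_gt.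
rewrite -ler_pdivrMl//; near: q; exact: nbhs_infty_ger.
Unshelve. all: by end_near. Qed.

Let mcell j q i : measurable (grid_cell (low j) snd q i).
Proof. exact: (measurable_grid_cell (mlow j) measurable_snd). Qed.

Let mS j q : measurable_fun setT (S j q).
Proof.
apply: measurable_funD.
  by apply: measurable_funD => //; exact: mB.
apply: measurable_sum => i; apply: measurable_funM => //.
apply: measurableT_comp; first exact: fine_measurable.
by have [_ mN _ _ _] := prm; exact: mN.
Qed.

Let mU j : measurable_fun setT (U j).
Proof.
have [_ mN _ _ _] := prm.
have mfin : measurable [set w | N w (low j) == +oo%E].
  rewrite -[X in measurable X]setTI.
  rewrite (_ : [set w | _] = N ^~ (low j) @^-1` [set +oo%E]).
    exact: mN.
  by apply/seteqP; split => w /eqP.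
apply: (@measurable_fun_cvg _ _ _ _ (fun q w => if N w (low j) == +oo%E then 0 else S j q w)).
  move=> q; apply: measurable_fun_if => //.
    by apply: (@measurable_fun_bool _ _ _ _ true); rewrite setTI.
  by apply: measurable_funS (mS j q).
move=> w _ /=; have [E|E] := eqVneq (N w (low j)) +oo%E.
  by rewrite /U E eqxx; exact: cvg_cst.
by apply: S_cvg; rewrite ltey.
Qed.

Let N_low_fin j w : ~ (exists j, N w (big j) = +oo%E) -> (N w (low j) < +oo)%E.
Proof.
move=> nfin; apply: (@le_lt_trans _ _ (N w (big j))).
  by apply: le_measure; rewrite ?inE// => x [? []].
by rewrite ltey; apply/eqP => H; apply: nfin; exists j.
Qed.

(** The inequality holds with equality for S j q, by independence, and passes to
the limit in q. *)
Let U_indep j r : (P [set w | (r < U j w)%R] * P G <= P ([set w | (r <= U j w)%R] `&` G))%E.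
Proof.
have mSr q : measurable [set w | r < S j q w] by exact: measurable_gt.
rewrite -(fineK (fin_num_measure P G mG)).
apply: (@event_fatou _ _ _ P [set w | exists j, N w (big j) = +oo%E] _ _
  (fun q => [set w | r < S j q w]) (fun q => [set w | r < S j q w] `&` G)) => //.
- exact: measurable_gt.
- by apply: measurableI => //; exact: measurable_ge.
- by move=> q; exact: measurableI.
- move=> q; rewrite fineK ?fin_num_measure//.
  have [_ _ iBN _] := XI.
  have H1 r' : [set w | r' < B w 1 + b j] = B ^~ 1 @^-1` `]r' - b j, +oo[%classic.
    by apply/seteqP; split => w /=; rewrite in_itv/= andbT ltrBlDr.
  rewrite (@prm_indep _ _ _ P _ _ _ N prm _
    (fun i : 'I_(2 * q ^ 2) => grid_cell (low j) snd q i) _ (fun i => mcell _ _ _)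
    mA0 _ _ _ (fun w => B w 1 + b j) (fun i => (i%:R - q%:R ^+ 2) / q%:R) _ _ iBN)//.
  + move=> i k _ _ ik; apply/val_inj; exact: trivIset_grid_cell ik.
  + move=> i; apply/seteqP; split => // z [[[_ /= [_ zy] _]] [_ /=]].
    by rewrite in_itv/= andbT leNgt zy.
  + move=> r'; rewrite H1 -[X in measurable X]setTI; exact: mB.
  + move=> r'; rewrite H1; apply: sub_gen_smallest; exists 1 => //=.
    by exists `]r' - b j, +oo[%classic.
- move=> w nfin /= rU.
  have /cvgrPdist_lt/(_ (U j w - r)) := S_cvg (N_low_fin j nfin).
  rewrite subr_gt0 => /(_ rU); apply: filterS => q.
  by rewrite ltr_norml => /andP[_]; rewrite ltrD2l ltrNl opprK.
- move=> w nfin rS; split; last by have [? _ []] := rS 0%N.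
  rewrite /= leNgt; apply/negP => Ur.
  have /cvgrPdist_lt/(_ (r - U j w)) := S_cvg (N_low_fin j nfin).
  rewrite subr_gt0 => /(_ Ur)[n _ nP]; have [q nq [/= rSq _]] := rS n.
  have := nP q nq; rewrite /= distrC ltr_norml => /andP[_].
  by rewrite ltrD2r ltNge ltW.
Qed.

Let big0E j : big j = low j `|` slab `[y, +oo[%classic.
Proof.
apply/seteqP; split => [[s x] [/= s01 hx]|[s x] [[/= s01 [hx _]]|[/= s01]]].
- by have [xy|yx] := ltP x y; [left|right]; split => //=; rewrite in_itv/= yx.
- by split.
- rewrite in_itv/= andbT => yx; split => //=.
  by rewrite (le_lt_trans (h1 j))// (lt_le_trans y1)// (le_trans yx)// ler_norm.
Qed.

(** The sum of the compensated and of the large jumps is one integral over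
h < |x|, which splits at y instead of 1. *)
Let path_cvg : exists2 N1 : set T, P.-negligible N1 & forall w, ~ N1 w ->
  [/\ forall j, N w (big j) <> +oo%E &
    B w 1 + b j + \int[N w]_(z in low j) z.2 @[j --> \oo] -->
    X w 1 - \int[N w]_(z in slab `[y, +oo[%classic) z.2].
Proof.
have [_ _ _ [J aeJ aeX]] := XI.
exists ([set w | exists j, N w (big j) = +oo%E] `|`
  (~` [set w | forall t, 0 <= t ->
    {uniform `[0, t], compensated_jumps nu (N w) h @[h --> 0^'+] --> J w}] `|`
   ~` [set w | forall s, 0 <= s -> X w s = s * a + B w s + J w s
            + \int[N w]_(z in `[0, s] `*` [set x | 1 < `|x|]) z.2])).
  by apply: negligibleU => //; apply: negligibleU.
move=> w /not_orP[nfin /not_orP[/contrapT/= wJ /contrapT/= wX]].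
have fin j : (N w (big j) < +oo)%E by rewrite ltey; apply/eqP => H; apply: nfin; exists j.
split => [j H|]; first by apply: nfin; exists j.
have int_big j : (N w).-integrable (big j) (EFin \o snd).
  exact: (integer_measure_integrable (intN w) (mbig j) (fin j) measurable_snd).
have mmid j : measurable (slab [set x | h j < `|x| <= 1]).
  apply: mslab; rewrite (_ : [set x | _] = [set x | h j < `|x|] `\` [set x | 1 < `|x|]).
    by apply: measurableD; exact: measurable_abs_gt.
  apply/seteqP; split => x /=.
    by move=> /andP[-> x1]; split => //; apply/negP; rewrite -leNgt.
  by move=> [-> /negP]; rewrite -leNgt.
have mbig1 : measurable (slab [set x | 1 < `|x|]).
  by apply: mslab; exact: measurable_abs_gt.
have bigE j : big j = slab [set x | h j < `|x| <= 1] `|` slab [set x | 1 < `|x|].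
  apply/seteqP; split => [[s x] [/= s01 hx]|[s x] [[/= s01 /andP[hx _]]|[/= s01 x1]]].
  - by have [x1|x1] := leP `|x| 1; [left|right]; split => //=; rewrite hx.
  - by split.
  - by split => //=; rewrite (le_lt_trans (h1 j)).
have E j : B w 1 + b j + \int[N w]_(z in low j) z.2 =
    a + B w 1 + compensated_jumps nu (N w) (h j) 1 +
    \int[N w]_(z in slab [set x | 1 < `|x|]) z.2
    - \int[N w]_(z in slab `[y, +oo[%classic) z.2.
  have H1 : \int[N w]_(z in big j) z.2 = \int[N w]_(z in low j) z.2 +
      \int[N w]_(z in slab `[y, +oo[%classic) z.2.
    rewrite big0E Rintegral_setU//; first by rewrite -big0E.
    apply/disj_setPS => -[s x] [[/= _ [_ xy]] [/= _]].
    by rewrite in_itv/= andbT leNgt xy.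
  have H2 : \int[N w]_(z in big j) z.2 =
      \int[N w]_(z in slab [set x | h j < `|x| <= 1]) z.2 +
      \int[N w]_(z in slab [set x | 1 < `|x|]) z.2.
    rewrite bigE Rintegral_setU//; first by rewrite -bigE.
    apply/disj_setPS => -[s x] [[/= _ /andP[_ xy]] [/= _]].
    by rewrite ltNge xy.
  rewrite /compensated_jumps mul1r /b; move: H1; rewrite H2.
  set i1 := \int[N w]_(z in _) _; set i2 := \int[N w]_(z in _) _.
  set i3 := \int[N w]_(z in _) _; set i4 := \int[N w]_(z in _) _ => H1.
  have -> : i3 = i1 + i2 - i4 by rewrite H1 addrK.
  ring.
under eq_fun do rewrite E.
rewrite wX// mul1r; apply: cvgB; last exact: cvg_cst.
apply: cvgD; last exact: cvg_cst.
apply: cvgD; first exact: cvg_cst.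
have J1 : compensated_jumps nu (N w) h' 1 @[h' --> 0^'+] --> J w 1.
  have H : {uniform [set 1], compensated_jumps nu (N w) h @[h --> 0^'+] --> J w}.
    apply: uniform_subset_cvg (wJ 1 ler01) => s /= ->.
    by rewrite in_itv/= ler01 lexx.
  by rewrite uniform_set1 in H.
by move/cvg_at_rightP : J1; apply; split => //; exact: cvg_harmonic.
Qed.

(** Without a jump of size at least y, X(1) is the limit of the U j; with one, it
exceeds this limit by at least y. On the left X(1) > r is intersected with the
complement of G, where the limit is X(1) itself. *)
Lemma levy_big_jump r :
  (P ([set w | (r < X w 1)%R] `&` ~` G) * P G <= P [set w | (r + y <= X w 1)%R])%E.
Proof.
have [N1 nN1 N1P] := path_cvg.
have mgt := measurable_gt; have mge := measurable_ge.
rewrite -[in leLHS](fineK (fin_num_measure P G mG)).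
apply: (@event_fatou _ _ _ P N1 _ _ (fun j => [set w | r < U j w])
  (fun j => [set w | r <= U j w] `&` G)) => //.
- by apply: measurableI; [exact: mgt|exact: measurableC].
- exact: mge.
- by move=> j; exact: mgt.
- by move=> j; apply: measurableI => //; exact: mge.
- by move=> j; rewrite fineK ?fin_num_measure//; exact: U_indep.
- move=> w /N1P[fin Xcvg] [/= rX /negP/negPn/eqP NA0].
  have V0 : \int[N w]_(z in slab `[y, +oo[%classic) z.2 = 0.
    rewrite /Rintegral null_set_integral//.
    by apply/measurable_EFinP; apply: measurable_funS measurable_snd.
  move: Xcvg; rewrite V0 subr0 => /cvgrPdist_lt/(_ (X w 1 - r)).
  rewrite subr_gt0 => /(_ rX); apply: filterS => j.
  rewrite /U lt_eqF; last by apply: N_low_fin => -[i]; exact: fin.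
  by rewrite ltr_norml => /andP[_]; rewrite ltrD2l ltrNl opprK.
- move=> w /N1P[fin Xcvg] UG; have [_ _ [_ /= NA0]] := UG 0%N.
  have A0big : slab `[y, +oo[%classic `<=` big 0 by rewrite big0E => x; right.
  have fin0 : (N w (slab `[y, +oo[%classic) < +oo)%E.
    apply: (@le_lt_trans _ _ (N w (big 0))).
      by apply: le_measure; rewrite ?inE.
    by rewrite ltey; apply/eqP/fin.
  have Vy : y <= \int[N w]_(z in slab `[y, +oo[%classic) z.2.
    apply: (@le_trans _ _ (\int[N w]_(z in slab `[y, +oo[%classic) y)).
      rewrite Rintegral_cst//; have := intN w mA0.
      move=> [E|[[|k] E]]; [by rewrite E in fin0|by move/eqP: NA0|].
      by rewrite [X in fine X]E /= ler_peMr// ?ler1n// (le_trans ler01)// ltW.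
    apply: (@le_Rintegral _ _ _ (N w) _ (fun=> y) snd) => //.
    - apply: measurable_bounded_integrable => //.
      by exists `|y|; split => // s ys x _ /=; exact: ltW.
    - exact: (integer_measure_integrable (intN w) mA0 fin0 measurable_snd).
    - by move=> [s x] [/= _]; rewrite in_itv/= andbT.
  apply: (@le_trans _ _ (r + \int[N w]_(z in slab `[y, +oo[%classic) z.2)).
    by rewrite lerD2l.
  rewrite -lerBrDr leNgt; apply/negP => Xr.
  have /cvgrPdist_lt/(_ (r - (X w 1 - \int[N w]_(z in slab `[y, +oo[%classic) z.2))) := Xcvg.
  rewrite subr_gt0 => /(_ Xr)[n _ nP]; have [j nj [/= rU _]] := UG n.
  move: rU; rewrite /U lt_eqF; last by apply: N_low_fin => -[i]; exact: fin.
  have := nP j nj; rewrite /= distrC ltr_norml => /andP[_].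
  by rewrite ltrD2r ltNge => /negP.
Qed.

End big_jump.

(** * A polynomial lower bound on the tail *)

(** For large x the quotient f(4x)/f(x) exceeds half its positive limit; iterating
this from x1 gives the geometric bound. *)
Lemma regularly_varying_geometric (R : realType) (f : R -> R) (rho C : R) :
  regularly_varying f rho ->
  exists x1 delta : R, [/\ C <= x1, 0 < f x1, 0 < delta &
    forall j : nat, delta ^+ j * f x1 <= f (4 ^+ j * x1)].
Proof.
move=> [x0 [_ fpos /(_ 4 (ltr0n _ 4))]] f4.
set L := 4 `^ rho in f4; have L0 : 0 < L by rewrite powR_gt0.
have /cvgrPdist_lt/(_ (L / 2)) := f4.
rewrite divr_gt0// => /(_ isT) [M [_ MP]].
pose x1 := Num.max (Num.max x0 C) (Num.max 1 (M + 1)).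
have x1C : C <= x1 by rewrite !le_max lexx orbT.
have x10 : x0 <= x1 by rewrite !le_max lexx.
have x11 : 1 <= x1 by rewrite !le_max lexx !orbT.
have x1M : M < x1 by rewrite !lt_max ltrDl ltr01 !orbT.
exists x1, (L / 2); split => //; [exact: fpos|by rewrite divr_gt0|].
have grow j : x1 <= 4 ^+ j * x1.
  by rewrite ler_peMl ?exprn_ege1 ?ler1n// (le_trans ler01).
elim=> [|j IH]; first by rewrite !expr0 !mul1r.
have := MP (4 ^+ j * x1) (lt_le_trans x1M (grow j)).
have fj : 0 < f (4 ^+ j * x1) by apply: fpos; exact: le_trans (grow j).
rewrite /= ltr_norml => /andP[_].
rewrite ltrBlDl -ltrBlDr => H.
have {}H : L / 2 < f (4 * (4 ^+ j * x1)) / f (4 ^+ j * x1) by move: H; lra.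
rewrite ltr_pdivlMr// in H; rewrite !exprS -!mulrA; apply: le_trans (ltW H).
by rewrite mulrA ler_pM2l ?divr_gt0.
Qed.

Section tail_bound.
Context {R : realType} {d} {T : measurableType d} (P : probability T R).
Context (nu : {measure set R -> \bar R}) (a sigma : R) (X : T -> R -> R)
  (B : T -> R -> R) (N : T -> {measure set (R * R) -> \bar R}).
Hypothesis nuL : levy_measure nu.
Hypothesis mX : measurable_fun setT (X ^~ 1).
Hypothesis XI : ito_representation P X a sigma B N nu.

Lemma levy_measure_itv_fin (y : R) : 0 < y -> (nu `[y, +oo[%classic < +oo)%E.
Proof.
move=> y0; apply: le_lt_trans (levy_measure_fin nuL (divr_gt0 y0 (ltr0n _ 2))).
apply: le_measure; rewrite ?inE//.
  exact: measurable_abs_gt.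
move=> x /=; rewrite in_itv/= andbT => yx.
rewrite (@lt_le_trans _ _ y)// ?(le_trans yx) ?ler_norm//.
by rewrite ltr_pdivrMr// ltr_pMr// ltr1n.
Qed.

Lemma levy_measure_small : exists2 y0 : R, 1 < y0 & forall y, y0 <= y ->
  (nu `[y, +oo[%classic <= (4^-1)%:E)%E.
Proof.
pose F n := `[n.+2%:R, +oo[%classic : set R.
have F0 : \bigcap_n F n = set0.
  apply/seteqP; split => // x Fx; have := Fx (Num.bound `|x|) I.
  rewrite /F /= in_itv/= andbT leNgt (le_lt_trans (ler_norm _))//.
  by rewrite (lt_le_trans (archi_boundP _))// ler_nat -addn2 leq_addr.
have mF n : measurable (F n) by exact: measurable_itv.
have nF : nonincreasing_seq F.
  move=> m n mn; apply/subsetPset => x; rewrite /F /= !in_itv/= !andbT.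
  by apply: le_trans; rewrite ler_nat !ltnS.
have F0fin : (nu (F 0%N) < +oo)%E by apply: levy_measure_itv_fin; rewrite ltr0n.
have := @nonincreasing_cvg_mu _ _ _ nu F F0fin mF.
rewrite F0 measure0 => /(_ measurable0 nF){nF} H.
have /H[n _ nF] : nbhs (0%E : \bar R) [set y | (y < (4^-1)%:E)%E].
  apply: open_nbhs_nbhs; split; first exact: open_ereal_lt_ereal.
  by rewrite /= lte_fin invr_gt0.
exists n.+2%:R; first by rewrite ltr1n.
move=> y ny; apply: le_trans (ltW (nF n (leqnn n))).
apply: le_measure; rewrite ?inE//= => x; rewrite /F /= !in_itv/= !andbT.
by apply: le_trans.
Qed.

(** In the inequality of levy_big_jump with r = -K, the factor
P(X(1) > -K, no big jump) is at least 3/4 - 1/4 once K and y are large, and a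
jump of size at least y has probability 1 - exp(-t) >= t/2, where t is the
mass of [y,+oo). *)
Lemma levy_tail_lower : exists K y0 : R, forall y, y0 <= y ->
  ((fine (nu `[y, +oo[%classic) / 4)%:E <= P [set w | (y - K <= X w 1)%R])%E.
Proof.
have [y0 y01 Hy0] := levy_measure_small.
have [K HK] : exists K : nat, ((3 / 4)%:E < P [set w | (- K%:R < X w 1)%R])%E.
  pose F K := [set w | - K%:R < X w 1].
  have mF K : measurable (F K) by exact: measurable_gt.
  have FT : \bigcup_K F K = setT.
    apply/seteqP; split => // w _; exists (Num.bound `|X w 1|) => //.
    by rewrite /F /= ltrNl (le_lt_trans _ (archi_boundP _))// -normrN ler_norm.
  have ndF : nondecreasing_seq F.
    move=> m n mn; apply/subsetPset => w; rewrite /F /=.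
    by apply: le_lt_trans; rewrite lerN2 ler_nat.
  have H : P \o F @ \oo --> 1%E.
    rewrite -(probability_setT P) -FT; apply: nondecreasing_cvg_mu => //.
    by rewrite FT.
  have /H[n _ nF] : nbhs (1%E : \bar R) [set y | ((3 / 4)%:E < y)%E].
    apply: open_nbhs_nbhs; split; first exact: open_ereal_gt_ereal.
    by rewrite /= lte_fin; lra.
  by exists n; exact: (nF n (leqnn n)).
exists K%:R, y0 => y y0y.
have y1 : 1 < y by exact: lt_le_trans y0y.
have nufin := levy_measure_itv_fin (lt_trans ltr01 y1).
have := levy_big_jump nuL mX XI y1 (- K%:R).
set G := [set w | N w _ != _] => H.
have mA : measurable (`[0, 1]%classic `*` `[y, +oo[%classic : set (R * R)).
  exact: measurableX.
have [_ prm _ _] := XI.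
have mG : measurable G by exact: (prm_preimage_measurable prm mA (@measurable_neq0 R)).
have PG : P G = (1 - expR (- fine (nu `[y, +oo[%classic)))%:E.
  by rewrite (prm_neq0 prm mA) jump_intensity_slab// measure_ge0.
rewrite addrC in H; apply: le_trans H.
set t := fine (nu _) in PG *.
have t0 : 0 <= t by rewrite fine_ge0.
have t4 : t <= 1 / 4.
  by rewrite -lee_fin fineK ?ge0_fin_numE// div1r; exact: Hy0.
have e1 : expR (- t) <= (1 + t)^-1.
  by rewrite expRN lef_pV2 ?posrE ?expR_gt0 ?expR_ge1Dx// ltr_wpDr.
have e2 : 1 - t <= expR (- t) by exact: expR_ge1Dx.
have e3 : (1 + t)^-1 <= 1 - t / 2.
  rewrite invf_ple ?posrE; last 2 first.
  - by rewrite ltr_wpDr.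
  - by lra.
  by rewrite -div1r ler_pdivrMr; nra.
set E := [set w | - K%:R < X w 1].
have mE : measurable E by exact: measurable_gt.
have EG : (P E - P G <= P (E `&` ~` G))%E.
  rewrite leeBlDr ?fin_num_measure//.
  apply: (@le_trans _ _ (P ((E `&` ~` G) `|` G))).
    apply: le_measure; rewrite ?inE//.
      by apply: measurableU => //; apply: measurableI => //; exact: measurableC.
    by move=> w Ew; have [Gw|nGw] := pselect (G w); [right|left].
  apply: measureU2 => //; apply: measurableI => //; exact: measurableC.
have half : ((1 / 2)%:E <= P (E `&` ~` G))%E.
  apply: le_trans EG; rewrite PG -(fineK (fin_num_measure P E mE)) -EFinB lee_fin.
  have : 3 / 4 < fine (P E) by rewrite -lte_fin fineK ?fin_num_measure.
  lra.
apply: (@le_trans _ _ ((1 / 2)%:E * P G)%E).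
  by rewrite PG -EFinM lee_fin; lra.
by apply: lee_wpmul2r.
Qed.

(** The starting point x1 is taken large enough for 4^j x1 - K to dominate
2 * 4^j + C. *)
Lemma levy_tail_geometric (alpha C : R) :
  regularly_varying (fun x : R => fine (nu `[x, +oo[%classic)) (- alpha) ->
  exists kappa delta : R, [/\ 0 < kappa, 0 < delta &
   forall j : nat, ((kappa * delta ^+ j)%:E <=
     P [set w | (2 * 4 ^+ j + C <= X w 1)%R])%E].
Proof.
move=> rv; have [K [y0 H]] := levy_tail_lower.
have [x1 [delta [x1C fx1 d0 Hj]]] :=
  regularly_varying_geometric (`|y0| + 2 + `|C| + `|K|) rv.
exists (fine (nu `[x1, +oo[%classic) / 4), delta; split => //.
  by rewrite divr_gt0.
move=> j.
have j1 : 1 <= 4 ^+ j :> R by rewrite exprn_ege1// ler1n.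
have := normr_ge0 y0; have := normr_ge0 C; have := normr_ge0 K.
have := ler_norm y0; have := ler_norm C; have := ler_norm K => kK cC yy k0 c0 yy0.
have yj : y0 <= 4 ^+ j * x1 by nra.
apply: (@le_trans _ _ (fine (nu `[4 ^+ j * x1, +oo[%classic) / 4)%:E).
  by rewrite lee_fin mulrAC ler_pM2r ?invr_gt0// mulrC.
apply: (le_trans (H _ yj)).
apply: le_measure; rewrite ?inE; [exact: measurable_ge|exact: measurable_ge|].
by move=> w /=; apply: le_trans; nra.
Qed.

End tail_bound.

(** * The probability of spread paths *)

Section spread_event.
Context {R : realType} {d} {T : measurableType d} (P : probability T R).
Context (X : T -> cadlag_path R) (a : R) (nu : {measure set R -> \bar R}).
Hypothesis XL : levy_process P X.
Let c := a + \int[nu]_(x in [set x | 1 < `|x|]) x.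

Lemma levy_increments_prob (n : nat) (r s : R) :
  P [set w | (forall i, (i < n)%N -> r <= X w i.+1%:R - X w i%:R) /\
     s <= X w n.+1%:R - X w n%:R] =
  (P [set w | (r <= X w 1)%R] ^+ n * P [set w | (s <= X w 1)%R])%E.
Proof.
have [mX _ indX statX _] := XL.
pose C (i : 'I_n.+1) : set R := if (i < n)%N then `[r, +oo[%classic else `[s, +oo[%classic.
have mC i : measurable (C i) by rewrite /C; case: ifP.
have nat_le (i : nat) : i%:R <= i.+1%:R :> R by rewrite ler_nat.
have H := indX n.+1 (fun i => i%:R) (lexx _) nat_le C mC.
have stat (i : nat) x : P [set w | x <= X w i.+1%:R - X w i%:R] = P [set w | x <= X w 1].
  have := statX i%:R i.+1%:R `[x, +oo[%classic.
  rewrite ler0n ler_nat leqnSn => /(_ isT (measurable_itv _)).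
  rewrite -natrB// subSnn => E.
  transitivity (P [set w | `[x, +oo[%classic (X w i.+1%:R - X w i%:R)]).
    by congr (P _); apply/seteqP; split => w /=; rewrite in_itv/= andbT.
  by rewrite E; congr (P _); apply/seteqP; split => w /=; rewrite in_itv/= andbT.
rewrite big_ord_recr /= in H.
transitivity (P (\bigcap_(i in [set: 'I_n.+1])
   (fun w => X w i.+1%:R - X w i%:R) @^-1` C i)).
  congr (P _); apply/seteqP; split => w.
    move=> [H1 H2] [i iltn] _ /=; rewrite /C /=; case: ifPn => i_n.
      by rewrite /= in_itv/= andbT; exact: H1.
    have -> : i = n by apply/eqP; rewrite eqn_leq -ltnS iltn leqNgt.
    by rewrite /= in_itv/= andbT.
  move=> H1; split => [i i_n|].
    have := H1 (Ordinal (ltnW i_n : (i < n.+1)%N)) I.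
    by rewrite /C /= i_n /= in_itv/= andbT.
  by have := H1 ord_max I; rewrite /C /= ltnn /= in_itv/= andbT.
rewrite H; congr (_ * _)%E.
  rewrite (eq_bigr (fun=> P [set w | r <= X w 1])) => [|i _].
    elim: n {C mC H stat} => [|n IH]; first by rewrite big_ord0 expe0.
    by rewrite big_ord_recl expeS IH.
  rewrite -(stat i); congr (P _); rewrite /C /= ltn_ord.
  by apply/seteqP; split => w /=; rewrite in_itv/= andbT.
rewrite -(stat n); congr (P _); rewrite /C /= ltnn.
by apply/seteqP; split => w /=; rewrite in_itv/= andbT.
Qed.

Lemma scaled_process_measurable n t : `[0, 1]%classic t ->
  measurable_fun setT (fun w => scaled_process X a nu n w t).
Proof.
move=> t01; have [mX _ _ _ _] := XL.
have t0 : 0 <= t by move: t01; rewrite /= in_itv/= => /andP[].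
rewrite (_ : (fun w => _) = fun w => X w (n%:R * t) / n%:R - t * c).
  apply: measurable_funB => //; apply: measurable_funM => //.
  by apply: mX; rewrite mulr_ge0.
by apply/funext => w; rewrite /= /scaled_path_fun ifT.
Qed.

(** Adding |c| to the increments absorbs the centering. The last increment puts
the unscaled centered values at the times 0 and m+1 at distance at least 2n^2,
so one of them is at least n^2 and the scaled path is at least n there. *)
Lemma scaled_process_spread (m n : nat) : (m.+1 <= n)%N ->
  (P [set w | (`|c| + 1 <= X w 1)%R] ^+ m *
   P [set w | (2 * n%:R ^+ 2 + `|c| <= X w 1)%R] <=
   P (scaled_process X a nu n @^-1` spread_paths m.+1))%E.
Proof.
move=> mn; rewrite -levy_increments_prob.
have n0 : (0 < n)%N by exact: leq_trans mn.
have n0R : 0 < n%:R :> R by rewrite ltr0n.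
have n1R : 1 <= n%:R :> R by rewrite ler1n.
have [mX _ _ _ _] := XL.
apply: le_measure; [apply/mem_set|apply/mem_set|].
- rewrite (_ : [set w | _] =
    (\bigcap_(i in [set i | (i < m)%N]) [set w | `|c| + 1 <= X w i.+1%:R - X w i%:R])
    `&` [set w | 2 * n%:R ^+ 2 + `|c| <= X w m.+1%:R - X w m%:R]) //.
  have mD (i : nat) : measurable_fun setT (fun w => X w i.+1%:R - X w i%:R).
    by apply: measurable_funB; apply: mX.
  apply: measurableI; last exact: measurable_ge.
  by apply: bigcap_measurableType => i _; exact: measurable_ge.
- by apply: spread_paths_measurable => t; exact: scaled_process_measurable.
move=> w /= [H1 H2] e e0.
(* The unscaled centered path at integer times. *)
pose Y (i : nat) := X w i%:R - i%:R * c.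
have grid01 (i : nat) : (i <= n)%N -> `[0, 1]%classic (i%:R / n%:R : R).
  by move=> i_n; rewrite /= in_itv/= divr_ge0//= ler_pdivrMr// mul1r ler_nat.
have gridE (i : nat) : (i <= n)%N ->
    scaled_process X a nu n w (i%:R / n%:R) = Y i / n%:R.
  move=> /grid01 i01; rewrite /= /scaled_path_fun ifT// mulrBl mulrCA divff ?gt_eqF//.
  by rewrite mulr1 mulrAC.
have cc := ler_norm c.
have Ystep i : (i < m)%N -> Y i + 1 <= Y i.+1.
  move=> im; have := H1 i im; rewrite /Y -natr1; lra.
have Ylast : Y m + 2 * n%:R ^+ 2 <= Y m.+1.
  move: H2; rewrite /Y -natr1; lra.
have Yge i l : (i + l <= m)%N -> Y i + l%:R <= Y (i + l)%N.
  elim: l => [|l IH] il; first by rewrite addn0 addr0.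
  rewrite addnS in il; have := Ystep _ il; have := IH (ltnW il).
  rewrite addnS -natr1; lra.
have [u [u01 uP]] : exists u, `[0, 1]%classic u /\ n%:R <= `|scaled_process X a nu n w u|.
  have n2 : Y 0%N + 2 * n%:R ^+ 2 <= Y m.+1.
    have := Yge 0%N m (leqnn _); rewrite add0n; have := ler0n R m; lra.
  have [Y0|Y0] := leP (n%:R ^+ 2) `|Y 0%N|.
    exists (0%:R / n%:R); split; first exact: grid01.
    by rewrite gridE// normrM normfV [X in _ / X]gtr0_norm// ler_pdivlMr// -expr2.
  exists (m.+1%:R / n%:R); split; first exact: grid01.
  rewrite gridE// normrM normfV [X in _ / X]gtr0_norm// ler_pdivlMr// -expr2.
  apply: le_trans (ler_norm _); move: Y0; rewrite ltr_norml => /andP[]; lra.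
exists (fun i : 'I_m.+1 => i%:R / n%:R), u; split => //.
  by move=> i; apply: grid01; apply: leq_trans mn; exact: ltnW.
move=> i j ij.
have sep (i' j' : 'I_m.+1) : (i' < j')%N -> 1 <= Y j' - Y i'.
  move=> ij'; have := Yge i' (j' - i')%N; rewrite subnKC ?(ltnW ij')// => /(_ _).
  have jm : (j' <= m)%N by rewrite -ltnS.
  move=> /(_ jm); have : 1 <= (j' - i')%:R :> R by rewrite ler1n subn_gt0.
  lra.
apply: (@le_trans _ _ (n%:R^-1)).
  rewrite lerBlDr (@le_trans _ _ n%:R^-1)//; last by rewrite lerDl ltW.
  by rewrite lef_pV2 ?posrE// ?ltr_pwDl// (le_trans uP)// lerDr.
rewrite !gridE; last 2 first.
- by apply: leq_trans mn; exact: ltnW.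
- by apply: leq_trans mn; exact: ltnW.
rewrite -mulrBl normrM normfV (gtr0_norm n0R) ler_peMl// ?invr_ge0//.
move: ij; rewrite neq_ltn => /orP[/sep|/sep] H.
  by rewrite distrC (le_trans H)// ler_norm.
by rewrite (le_trans H)// ler_norm.
Qed.

End spread_event.

(** * Failure of the upper bound *)

Lemma limn_esup_ge_frequently (R : realType) (u : nat -> \bar R) (b : \bar R) :
  (forall n : nat, exists2 k, (n <= k)%N & (b <= u k)%E) -> (b <= limn_esup u)%E.
Proof.
move=> H; rewrite limn_esup_lim; apply: lime_ge; first exact: is_cvg_esups.
apply: nearW => n; have [k nk bk] := H n.
by apply: le_trans bk _; apply: ereal_sup_ubound; exists k.
Qed.

(** The constant C disappears in the limit: as soon as j ln 2 >= |ln C| it costs at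
most the additional 1 in the bound. *)
Lemma geometric_lower_log (R : realType) (p : nat -> \bar R) (C delta : R) :
  (forall n, p n \is a fin_num) -> 0 < C -> 0 < delta ->
  (\forall j \near \oo, ((C * delta ^+ j)%:E <= p (2 ^ j)%N)%E) ->
  ((- (`|ln delta| / ln 2 + 1))%:E <=
    limn_esup (fun n => lne (p n) * ((ln n%:R)^-1)%:E))%E.
Proof.
move=> pfin C0 d0 [j0 _ j0P].
apply: limn_esup_ge_frequently => n.
have ln2 : 0 < ln 2 :> R by rewrite ln_gt0// ltr1n.
pose j := maxn (maxn n j0) (Num.bound (`|ln C| / ln 2)).+1.
have nj : (n <= j)%N by rewrite !leq_max leqnn.
have j0j : (j0 <= j)%N by rewrite !leq_max leqnn orbT.
have jC : `|ln C| <= j%:R * ln 2.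
  rewrite -ler_pdivrMr// (le_trans (ltW (archi_boundP _)))//.
    by rewrite divr_ge0// ltW.
  by rewrite ler_nat leq_max leqnSn orbT.
have jpos : (0 < j)%N by rewrite leq_max orbT.
exists (2 ^ j)%N; first by rewrite (leq_trans nj)// ltnW// ltn_expl.
have := j0P j j0j; rewrite /= -(fineK (pfin (2 ^ j)%N)) lee_fin.
set q := fine _ => Cq.
have Cd0 : 0 < C * delta ^+ j by rewrite mulr_gt0// exprn_gt0.
have q0 : 0 < q by exact: lt_le_trans Cq.
have jl : 0 < j%:R * ln 2 :> R by rewrite mulr_gt0// ltr0n.
rewrite lne_EFin// -EFinM lee_fin natrX lnXn// -[ln 2 *+ j]mulr_natl ler_pdivlMr//.
apply: (@le_trans _ _ (ln (C * delta ^+ j))); last by rewrite ler_ln ?posrE.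
rewrite (@lnM _ C (delta ^+ j)) ?posrE ?exprn_gt0// (@lnXn _ j delta)// -[ln delta *+ j]mulr_natl.
have -> : - (`|ln delta| / ln 2 + 1) * (j%:R * ln 2) =
   - (j%:R * `|ln delta|) - j%:R * ln 2 by field; rewrite gt_eqF.
rewrite [leRHS]addrC; apply: lerD.
  by rewrite -mulrN ler_wpM2l// lerNl -normrN ler_norm.
by rewrite lerNl (le_trans _ jC)// -normrN ler_norm.
Qed.

Theorem mainTheorem9 (R : realType) (d : measure_display) (T : measurableType d)
    (P : probability T R) (nu : {measure set R -> \bar R})
    (a sigma alpha beta : R) (X : T -> cadlag_path R) (B : T -> R -> R)
    (N : T -> {measure set (R * R) -> \bar R}) :
  levy_measure nu ->
  0 <= sigma ->
  levy_process P X ->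
  ito_representation P X a sigma B N nu ->
  1 < alpha -> 1 < beta ->
  regularly_varying (fun x : R => fine (nu `[x, +oo[%classic)) (- alpha) ->
  regularly_varying (fun x : R => fine (nu `]-oo, - x]%classic)) (- beta) ->
  ~ ldp_upper_bound P (scaled_process X a nu) (fun n => ln n%:R)
      (rate_I alpha beta) /\
  ~ full_ldp P (scaled_process X a nu) (fun n => ln n%:R) (rate_I alpha beta).
Proof.
move=> nuL _ XL XI a1 b1 rva _.
suff noub : ~ ldp_upper_bound P (scaled_process X a nu) (fun n => ln n%:R)
    (rate_I alpha beta) by split => // -[].
move=> ub.
have mX1 : measurable_fun setT (fun w => X w 1) by have [+ _ _ _ _] := XL; exact.
pose c := a + \int[nu]_(x in [set x | 1 < `|x|]) x.
have [kappa [delta [k0 d0 tail]]] :=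
  levy_tail_geometric nuL mX1 XI `|c| rva.
pose mu := Num.min (alpha - 1) (beta - 1).
have mu0 : 0 < mu by rewrite lt_min !subr_gt0 a1.
pose A := `|ln delta| / ln 2 + 1.
(* A is the exponent of the lower bound on the probability; it was fixed before
   the number m of jumps. *)
have [m Am] : exists m : nat, A < mu * m%:R.
  have A0 : 0 <= A by rewrite addr_ge0// divr_ge0// ln_ge0// ler1n.
  exists (Num.bound (A / mu)); rewrite mulrC -ltr_pdivrMr//.
  by apply: archi_boundP; rewrite divr_ge0// ltW.
pose q := P [set w | (`|c| + 1 <= X w 1)%R].
have mge := measurable_ge mX1.
have q0 : (0 < fine q).
  rewrite -lte_fin fineK ?fin_num_measure//.
  apply: (@lt_le_trans _ _ (kappa * delta ^+ 0)%:E).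
    by rewrite lte_fin mulr_gt0// exprn_gt0.
  apply: (le_trans (tail 0%N)); apply: le_measure; [exact/mem_set|exact/mem_set|].
  by move=> w /=; apply: le_trans; rewrite expr0 mulr1 addrC lerD2r ler1n.
have := ub _ (@spread_paths_closed R m.+1).
apply/negP; rewrite -ltNge.
apply: (@le_lt_trans _ _ (- (mu * m%:R)%:E)%E).
  rewrite leeN2; apply: le_ereal_inf_tmp => _ [xi xiF <-].
  exact: rate_spread.
apply: (@lt_le_trans _ _ (- A)%:E); first by rewrite -EFinN lte_fin ltrN2.
apply: (@geometric_lower_log _ _ (fine q ^+ m * kappa)) => //.
- move=> n; apply: fin_num_measure; apply: spread_paths_measurable => t.
  exact: (scaled_process_measurable _ _ XL).
- by rewrite mulr_gt0// exprn_gt0.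
exists m.+1 => // j /= mj.
apply: le_trans (scaled_process_spread a nu XL _); last first.
  by rewrite (leq_trans mj)// ltnW// ltn_expl.
rewrite -/c -/q -mulrA EFinM EFin_expe fineK ?fin_num_measure//.
apply: lee_wpmul2l; first by apply: expe_ge0; exact: measure_ge0.
have -> : (2 ^ j)%:R ^+ 2 = 4 ^+ j :> R by rewrite natrX exprAC -natrX.
exact: tail.
Qed.
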